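(* Let $(\gamma(n))_n\subset(0,1-\delta)$ be a sequence such that $\lim_{n\to\infty}n\gamma(n)=0$, and let $c_n\in(0,\frac1n)$, $n\ge1$, be chosen such that $$\sup_{r\in(1-\gamma(n),1)}|f_{c_n,n}(r)|\,u(r)>1-\frac1n .$$ Then, for $X=H^\infty_u$ or $X=H^0_u$, $$\|I_K\|_{e,X\to H^\infty_u}\ge\liminf_{n\to\infty}\ \inf_{r\in(1-\gamma(n),1)}|C_{c_n,n}(r)| .$$ If moreover $\frac{g(\phi_t(r))}{g(r)}T_t(r)\in[0,\infty)$ for all $r,t\in(0,1)$, then $$\|I_K\|_{e,X\to H^\infty_u}\ge\int_0^1\liminf_{r\to1}\frac{g(\phi_t(r))}{g(r)}T_t(r)\,dt .$$
   Context: $\mathbb D$ is the open unit disk, $\mathcal H(\mathbb D)$ the analytic functions on $\mathbb D$, $H^\infty$ the bounded ones; $r$ denotes real numbers in $(0,1)$, and $r\to1$ from below. Spaces. $u:\mathbb D\to(0,\infty)$ is continuous and radial ($u(z)=u(|z|)$) with $\sup_{\mathbb D}u=1$ and $u(z)\to0$ as $|z|\to1$; $H^\infty_u=\{f\in\mathcal H(\mathbb D):\|f\|_{H^\infty_u}=\sup_{\mathbb D}|f|u<\infty\}$, $H^0_u=\{f\in H^\infty_u:\lim_{|z|\to1}|f(z)|u(z)=0\}$ with the same norm. Standing assumptions: point evaluations $\delta_z$, $z\in\mathbb D$, are bounded on $H^\infty_u$ and $\int_0^1\|\delta_s\|_{(H^\infty_u)^*}\,ds<\infty$. Operator. $K:\mathbb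 D\times\mathbb D\to\mathbb C$ is analytic, $K(z,\cdot)\in H^\infty$ for every $z\in\mathbb D$, $\lim_{(z,w)\to(1,1)}|K(z,w)|=\infty$, and $I_K(f)(z)=\int_0^1f(x)K(z,x)\,dx$ is assumed bounded $H^\infty_u\to H^\infty_u$. For $t\in(0,1)$, $z\in\mathbb D$: $\phi_t(z)=\frac{t}{(t-1)z+1}$ and $T_t(z)=K(z,\phi_t(z))\frac{\partial}{\partial t}\phi_t(z)=K(z,\phi_t(z))\frac{1-z}{((t-1)z+1)^2}$. Test functions. $g\in\mathcal H(\mathbb D)$ satisfies $\sup_{z\in\mathbb D}|g(z)|u(z)\le1$; $\limsup_{z\to e^{i\theta}}|g(z)|u(z)=0$ for every boundary point $e^{i\theta}\ne1$; and $|g(r)|u(r)\to1$ as $r\to1$. For $c\ge0$ and integers $n\ge1$, $f_{c,n}(z)=z^ng(z)(1-z)^c$ (principal power). $\delta\in(0,1)$ is fixed so that $g$ has no zeros on $(\delta,1)$, and for $r\in(\delta,1)$ $$C_{c,n}(r)=\int_0^1\Big(\frac1{1-t}-r\Big)^{-c}\Big(\frac{\phi_t(r)}{r}\Big)^n\frac{g(\phi_t(r))}{g(r)}T_t(r)\,dt .$$ Numbers $c_n$ as in the claim exist for every such sequence $(\gamma(n))_n$. Essential norm. $\|T\|_{e,X\to Y}=\inf\{\|T-L\|_{X\to Y}:L:X\to Y\text{ compact}\}$; for $X=H^0_u$ the operator is the restriction of $I_K$. *)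

(* Defs.v *)
From HB Require Import structures.
From mathcomp Require Import all_boot all_order all_algebra complex.
From mathcomp Require Import all_classical all_reals all_analysis.

Set Implicit Arguments.
Unset Strict Implicit.
Unset Printing Implicit Defensive.

Import Order.TTheory GRing.Theory Num.Theory.
Import numFieldNormedType.Exports.

Local Open Scope classical_set_scope.
Local Open Scope ring_scope.
Local Open Scope complex_scope.

(* Functions on the unit disk are total functions R[i] -> R[i] whose values
   outside the disk are irrelevant: every notion below only looks at the values
   on the disk, so functions that agree there are identified. *)

Section Disk.
Variable R : realType.
Local Notation C := R[i].

(* [`|z|] is an element of R[i]; this is the modulus as an element of R. *)
Definition modulus (z : C) : R := complex.Re `|z|.

Definition disk : set C := [set z | modulus z < 1].

(* Sets containing {z | rho < |z| < 1} for some rho < 1: the filter for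
   limits as |z| -> 1 in the disk. *)
Definition to_circle : set_system C :=
  filter_from [set rho : R | rho < 1] (fun rho => [set z | rho < modulus z < 1]).

Definition holomorphic (f : C -> C) : Prop :=
  forall z, disk z -> derivable (f : C^o -> C^o) z 1.

Definition holomorphic2 (K : C -> C -> C) : Prop :=
  forall p : C^o * C^o, disk p.1 -> disk p.2 ->
    differentiable (fun q : C^o * C^o => K q.1 q.2 : C^o) p.

(* H^infty *)
Definition Hinf : set (C -> C) :=
  [set f | holomorphic f /\ exists M : R, forall z, disk z -> modulus (f z) <= M].

(* Principal argument, in ]-pi, pi]; its value at 0 is irrelevant. *)
Definition Arg (z : C) : R :=
  let theta := acos (complex.Re z / modulus z) in
  if 0 <= complex.Im z then theta else - theta.

(* Principal power, z^c = exp(c Log z), for z != 0 and a real exponent c. *)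
Definition cpow (z : C) (c : R) : C :=
  (modulus z `^ c)%:C * (cos (c * Arg z) +i* sin (c * Arg z)).

(* Lebesgue integral over ]0, 1[ of a complex-valued function. *)
Definition cint01 (h : R -> C) : C :=
  (\int[lebesgue_measure]_(x in `]0, 1[) complex.Re (h x))
  +i* (\int[lebesgue_measure]_(x in `]0, 1[) complex.Im (h x)).

End Disk.

Section Weighted.
Variables (R : realType) (u : R[i] -> R).
Local Notation C := R[i].

Definition is_weight : Prop :=
  [/\ forall z, disk z -> 0 < u z,
      forall z, disk z -> {for z, continuous (u : C^o -> R)},
      forall z, disk z -> u z = u (modulus z)%:C,
      ereal_sup [set (u z)%:E | z in @disk R] = 1%E
    & u z @[z --> @to_circle R] --> (0 : R)].

Definition unorm (f : C -> C) : \bar R :=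
  ereal_sup [set (modulus (f z) * u z)%:E | z in @disk R].

Definition Hinf_u : set (C -> C) :=
  [set f | holomorphic f /\ (unorm f < +oo)%E].

Definition H0_u : set (C -> C) :=
  [set f | Hinf_u f /\
     modulus (f z) * u z @[z --> @to_circle R] --> (0 : R)].

(* Norm of the point evaluation at z on H^infty_u. *)
Definition delta_norm (z : C) : \bar R :=
  ereal_sup [set (modulus (f z))%:E | f in
    [set f | Hinf_u f /\ (unorm f <= 1)%E]].

(* Operators X -> H^infty_u, for X one of the subspaces H^infty_u, H^0_u.  An
   operator is a map on functions, of which only the action on X matters. *)

Definition op_norm (X : set (C -> C)) (T : (C -> C) -> (C -> C)) : \bar R :=
  ereal_sup [set unorm (T f) | f in [set f | X f /\ (unorm f <= 1)%E]].

Definition bounded_op (X : set (C -> C)) (T : (C -> C) -> (C -> C)) : Prop :=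
  (forall f, X f -> Hinf_u (T f)) /\ (op_norm X T < +oo)%E.

Definition linear_op (X : set (C -> C)) (T : (C -> C) -> (C -> C)) : Prop :=
  forall (a : C) f g, X f -> X g ->
    forall z, disk z -> T (fun w => a * f w + g w) z = a * T f z + T g z.

Definition compact_op (X : set (C -> C)) (T : (C -> C) -> (C -> C)) : Prop :=
  [/\ forall f, X f -> Hinf_u (T f),
      linear_op X T
    & forall f_ : nat -> (C -> C),
        (forall k, X (f_ k) /\ (unorm (f_ k) <= 1)%E) ->
        exists (s : nat -> nat) (h : C -> C),
          [/\ {homo s : m n / (m < n)%N},
              Hinf_u h
            & unorm (fun z => T (f_ (s k)) z - h z) @[k --> \oo] --> 0%E]].

Definition essential_norm (X : set (C -> C)) (T : (C -> C) -> (C -> C)) : \bar R :=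
  ereal_inf [set op_norm X (fun f z => T f z - L f z) | L in compact_op X].

End Weighted.

Section Operator.
Variables (R : realType) (K : R[i] -> R[i] -> R[i]).
Local Notation C := R[i].

Definition is_kernel : Prop :=
  [/\ holomorphic2 K,
      forall z, disk z -> Hinf (K z)
    & modulus (K p.1 p.2) @[p --> within [set p : C^o * C^o | disk p.1 /\ disk p.2]
                                  (nbhs ((1, 1) : C^o * C^o))] --> +oo].

Definition I_op (f : C -> C) (z : C) : C :=
  cint01 (fun x => f x%:C * K z x%:C).

Definition phi (t : R) (z : C) : C := t%:C / ((t%:C - 1) * z + 1).

(* The second factor is the derivative of t |-> phi t z. *)
Definition T_K (t : R) (z : C) : C :=
  K z (phi t z) * ((1 - z) / ((t%:C - 1) * z + 1) ^+ 2).

Definition C_K (g : C -> C) (c : R) (n : nat) (r : R) : C :=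
  cint01 (fun t =>
    (((1 - t)^-1 - r) `^ (- c))%:C * (phi t r%:C / r%:C) ^+ n
    * (g (phi t r%:C) / g r%:C) * T_K t r%:C).

End Operator.

Section TestFunctions.
Variables (R : realType) (u : R[i] -> R) (g : R[i] -> R[i]).
Local Notation C := R[i].

Definition is_test_function : Prop :=
  [/\ holomorphic g,
      (unorm u g <= 1)%E,
      forall zeta : C, modulus zeta = 1 -> zeta != 1 ->
        limf_esup (fun z : C^o => (modulus (g z) * u z)%:E)
          (within (@disk R) (nbhs (zeta : C^o))) = 0%E
    & modulus (g r%:C) * u r%:C @[r --> (1 : R)^'-] --> (1 : R)].

Definition test_f (c : R) (n : nat) (z : C) : C := z ^+ n * g z * cpow (1 - z) c.

End TestFunctions.

(* Main.v *)
Require Import Defs.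
From HB Require Import structures.
From mathcomp Require Import all_boot all_order all_algebra complex.
From mathcomp Require Import all_classical all_reals all_analysis.
From mathcomp Require Import measurable_realfun ring lra.

Set Implicit Arguments.
Unset Strict Implicit.
Unset Printing Implicit Defensive.

Import Order.TTheory GRing.Theory Num.Theory.
Import numFieldNormedType.Exports.

Local Open Scope classical_set_scope.
Local Open Scope ring_scope.
Local Open Scope complex_scope.

(* The functions [F_n = (1 - c_n) f_{c_n,n}] lie in the unit ball of [H^0_u], since
   [2^c (1 - c) <= 1], and satisfy [|F_n(z)| u(z) <= |z|^n].  A gliding hump argument
   then shows that a compact [L] satisfies [||L F_n|| -> 0] along a subsequence, so
   [||I_K - L||] is at least the limit inferior of [||I_K F_n||].  The substitution
   [x = phi_t(r)] gives [I_K F_n (r) = F_n(r) C_{c_n,n}(r)], because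
   [1 - phi_t(r) = (1 - r) / (1/(1 - t) - r)]; evaluating at a point of
   [(1 - gamma(n), 1)] where [|F_n| u] is close to 1 gives the first bound.  The second
   follows from it by Fatou's lemma: for fixed [t] the factors
   [(1/(1 - t) - r)^(-c_n)] and [(phi_t(r)/r)^n] are eventually at least [1 - o(1)],
   uniformly in [r > 1 - gamma(n)], as [n gamma(n) -> 0]. *)

(** * Modulus and topology of the complex numbers *)

(** The power [(1 - z)^c] is in the test functions because [|g| u] tends to 1 along the radius to 1,
    so that [z^n g] is not in [H0_u]; the power supplies the missing decay at that single boundary
    point. The usual route to [||L F_n|| -> 0] is weak convergence to 0, which needs a hold on the
    dual space. The gliding hump replaces it by evaluations of [L] at one point, and its finite sums
    of test functions remain in [H0_u], so both choices of [X] are covered by the inclusion of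
    [H0_u] in [X]. The supremum that selects [c_n] and the infimum in the bound range over the same
    interval: wherever the test function is large, [|C|] is at least the infimum, and no further
    control of that radius is required. In the second bound the inner limit inferior runs over real
    [r], and its measurability in [t] is not at hand; it is first bounded by a limit inferior along
    a sequence of nearly minimising radii, and Fatou's lemma is applied to that sequence. *)

Section Modulus.
Variable R : realType.
Local Notation C := R[i].
Implicit Types (z w : C) (x : R).

Lemma modulusE z : (modulus z)%:C = `|z|.
Proof. by rewrite /modulus normc_def. Qed.

Lemma modulus_sqrt z : modulus z = Num.sqrt (complex.Re z ^+ 2 + complex.Im z ^+ 2).
Proof. by rewrite /modulus normc_def. Qed.

Lemma modulus_ge0 z : 0 <= modulus z.
Proof. by rewrite modulus_sqrt sqrtr_ge0. Qed.

Lemma modulus0 : modulus (0 : C) = 0.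
Proof. by apply: complexI; rewrite modulusE normr0. Qed.

Lemma modulus1 : modulus (1 : C) = 1.
Proof. by apply: complexI; rewrite modulusE normr1. Qed.

Lemma modulus_eq0 z : (modulus z == 0) = (z == 0).
Proof. by rewrite -(inj_eq (@complexI R)) modulusE rmorph0 normr_eq0. Qed.

Lemma modulus_gt0 z : (0 < modulus z) = (z != 0).
Proof. by rewrite lt0r modulus_eq0 modulus_ge0 andbT. Qed.

Lemma modulusM z w : modulus (z * w) = modulus z * modulus w.
Proof. by apply: complexI; rewrite rmorphM /= !modulusE normrM. Qed.

Lemma modulusX z n : modulus (z ^+ n) = modulus z ^+ n.
Proof. by apply: complexI; rewrite rmorphXn /= !modulusE normrX. Qed.

Lemma modulusV z : modulus (z^-1) = (modulus z)^-1.
Proof. by apply: complexI; rewrite fmorphV /= !modulusE normfV. Qed.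

Lemma modulusN z : modulus (- z) = modulus z.
Proof. by rewrite /modulus normrN. Qed.

Lemma modulusB z w : modulus (z - w) = modulus (w - z).
Proof. by rewrite /modulus distrC. Qed.

Lemma ler_modulusD z w : modulus (z + w) <= modulus z + modulus w.
Proof. by rewrite -lecR rmorphD /= !modulusE ler_normD. Qed.

Lemma ler_modulusB z w : modulus (z - w) <= modulus z + modulus w.
Proof. by rewrite -(modulusN w) ler_modulusD. Qed.

Lemma modulus_real x : modulus x%:C = `|x|.
Proof. by rewrite modulus_sqrt /= expr0n addr0 sqrtr_sqr. Qed.

Lemma normr_Re_le z : `|complex.Re z| <= modulus z.
Proof.
by rewrite modulus_sqrt -sqrtr_sqr ler_wsqrtr // lerDl sqr_ge0.
Qed.

Lemma normr_Im_le z : `|complex.Im z| <= modulus z.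
Proof.
by rewrite modulus_sqrt -sqrtr_sqr ler_wsqrtr // lerDr sqr_ge0.
Qed.

Lemma modulus_le_ReIm z : modulus z <= `|complex.Re z| + `|complex.Im z|.
Proof.
rewrite modulus_sqrt -[leRHS]ger0_norm ?addr_ge0 // -sqrtr_sqr ler_wsqrtr //.
rewrite sqrrD !real_normK ?num_real //.
by rewrite lerD2r lerDl mulrn_wge0 // mulr_ge0.
Qed.

Lemma modulus_polar z :
  complex.Re z ^+ 2 + complex.Im z ^+ 2 = modulus z ^+ 2.
Proof. by rewrite modulus_sqrt sqr_sqrtr // addr_ge0 ?sqr_ge0. Qed.

Lemma real_complex_disk x : disk x%:C = (`|x| < 1).
Proof. by rewrite /disk /= modulus_real. Qed.

Lemma ReM_real (x : R) z : complex.Re (x%:C * z) = x * complex.Re z.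
Proof. by case: z => a b /=; rewrite mul0r subr0. Qed.

Lemma ImM_real (x : R) z : complex.Im (x%:C * z) = x * complex.Im z.
Proof. by case: z => a b /=; rewrite mul0r addr0. Qed.

(** Balls of [C^o] have radii in [R[i]]. A positive element of [R[i]] is real, so its real part can
    serve as the radius. *)
Lemma nbhs_modulusP (z : C^o) (A : set C^o) :
  nbhs z A <-> exists2 e : R, 0 < e & forall w : C, modulus (z - w) < e -> A w.
Proof.
split.
  case/nbhs_ballP => e /= e0 eA.
  have eR : e = (complex.Re e)%:C by rewrite RRe_real // gtr0_real.
  exists (complex.Re e); first by rewrite -ltcR -eR.
  move=> w zw; apply: eA; rewrite /ball /= -modulusE eR ltcR //.
case=> e e0 eA; apply/nbhs_ballP; exists e%:C => /=; first by rewrite ltcR.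
by move=> w; rewrite /ball /= -modulusE ltcR; exact: eA.
Qed.

Lemma cvg_modulusP {T : Type} (F : set_system T) {FF : Filter F} (f : T -> C^o) (l : C^o) :
  f @ F --> l <-> forall e : R, 0 < e -> \forall x \near F, modulus (l - f x) < e.
Proof.
split=> [fl e e0|H A /nbhs_modulusP[e e0 eA]].
  by apply: (fl [set w | modulus (l - w) < e]); apply/nbhs_modulusP; exists e.
by rewrite /nbhs /=; apply: filterS (H e e0) => x; exact: eA.
Qed.

Lemma cvg_Re {T : Type} (F : set_system T) {FF : Filter F} (f : T -> C^o) (l : C^o) :
  f @ F --> l -> complex.Re (f x) @[x --> F] --> complex.Re l.
Proof.
move=> /cvg_modulusP fl; apply/cvgrPdist_lt => e e0.
apply: filterS (fl e e0) => x; apply: le_lt_trans.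
by rewrite -(raddfB (@complex.Re R : Rcomplex R -> R)) normr_Re_le.
Qed.

Lemma cvg_Im {T : Type} (F : set_system T) {FF : Filter F} (f : T -> C^o) (l : C^o) :
  f @ F --> l -> complex.Im (f x) @[x --> F] --> complex.Im l.
Proof.
move=> /cvg_modulusP fl; apply/cvgrPdist_lt => e e0.
apply: filterS (fl e e0) => x; apply: le_lt_trans.
by rewrite -(raddfB (@complex.Im R : Rcomplex R -> R)) normr_Im_le.
Qed.

Lemma continuous_Re : continuous (@complex.Re R : C^o -> R).
Proof. by move=> z; exact: (@cvg_Re C^o (nbhs (z : C^o)) _ id z cvg_id). Qed.

Lemma continuous_Im : continuous (@complex.Im R : C^o -> R).
Proof. by move=> z; exact: (@cvg_Im C^o (nbhs (z : C^o)) _ id z cvg_id). Qed.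

Lemma cvg_complex {T : Type} (F : set_system T) {FF : Filter F} (f : T -> C^o) (l : C^o) :
  complex.Re (f x) @[x --> F] --> complex.Re l ->
  complex.Im (f x) @[x --> F] --> complex.Im l -> f @ F --> l.
Proof.
move=> /cvgrPdist_lt fr /cvgrPdist_lt fi; apply/cvg_modulusP => e e0.
have e2 : 0 < e / 2 by rewrite divr_gt0.
near=> x; apply: le_lt_trans (modulus_le_ReIm _) _.
rewrite (raddfB (@complex.Re R : Rcomplex R -> R)) (raddfB (@complex.Im R : Rcomplex R -> R)) /=.
rewrite (splitr e) ltrD //; near: x; [exact: fr|exact: fi].
Unshelve. all: by end_near. Qed.

Lemma cvg_modulus {T : Type} (F : set_system T) {FF : Filter F} (f : T -> C^o) (l : C^o) :
  f @ F --> l -> modulus (f x) @[x --> F] --> modulus l.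
Proof.
move=> /cvg_modulusP fl; apply/cvgrPdist_lt => e e0.
apply: filterS (fl e e0) => x; apply: le_lt_trans.
rewrite ler_norml; apply/andP; split.
  rewrite lerNl opprB lerBlDr -(modulusB (f x)).
  by apply: le_trans (ler_modulusD _ _); rewrite subrK.
by rewrite lerBlDr; apply: le_trans (ler_modulusD _ _); rewrite subrK.
Qed.

Lemma continuous_modulus : continuous (@modulus R : C^o -> R).
Proof. by move=> z; exact: (@cvg_modulus C^o (nbhs (z : C^o)) _ id z cvg_id). Qed.

Lemma cvg_real_complex {T : Type} (F : set_system T) {FF : Filter F} (f : T -> R) (l : R) :
  f @ F --> l -> ((f x)%:C : C^o) @[x --> F] --> (l%:C : C^o).
Proof. by move=> fl; apply: cvg_complex => //=; exact: cvg_cst. Qed.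

Lemma continuous_real_complex : continuous (fun x : R => x%:C : C^o).
Proof. by move=> x; apply: cvg_real_complex; exact: cvg_id. Qed.

Lemma holomorphic_continuous (f : C -> C) (z : C) :
  holomorphic f -> disk z -> {for z, continuous (f : C^o -> C^o)}.
Proof. by move=> fh zD; apply/differentiable_continuous/derivable1_diffP/fh. Qed.

End Modulus.

(** * Holomorphy of the principal power *)

Section ComplexPower.
Variable R : realType.
Local Notation C := R[i].
Implicit Types (z w : C) (x y : R).

Lemma is_derive_approx (f : R -> R) (x l e : R) : is_derive x 1 f l -> 0 < e ->
  \forall h \near 0, `|f (h + x) - f x - l * h| <= e * `|h|.
Proof.
move=> [fx fl] e0; have /eqaddoP /(_ e e0) := derivable_nbhs fx.
apply: filterS => h /=; rewrite /cst !fctE /= fl.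
by rewrite scaler1 opprD addrA [h *: l]mulrC.
Qed.

Lemma derivable_complex_approx (f : C -> C) (z l : C) :
  (forall e : R, 0 < e -> \forall h \near (0 : C^o),
    modulus (f (z + h) - f z - l * h) <= e * modulus h) ->
  derivable (f : C^o -> C^o) z 1.
Proof.
move=> H; apply/cvg_ex; exists (l : C^o); apply/cvg_modulusP => e e0.
near=> h.
have h0 : h != 0 by near: h; exact: nbhs_dnbhs_neq.
rewrite /= [_ *: (1 : C^o)]mulr1 -[l](mulKf h0) -mulrBr modulusM modulusV.
rewrite modulusB mulrC ltr_pdivrMr ?modulus_gt0 // [h * l]mulrC (addrC h z).
(* Halving [e] makes room for the strict inequality. *)
apply: (@le_lt_trans _ _ (e / 2 * modulus h)); last first.
  by rewrite ltr_pM2r ?modulus_gt0 // ltr_pdivrMr // ltr_pMr // ltr1n.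
near: h; apply: nbhs_dnbhs; apply: H; exact: divr_gt0.
Unshelve. all: by end_near. Qed.

(** * The complex exponential *)

Definition cexp z : C :=
  (expR (complex.Re z))%:C * (cos (complex.Im z) +i* sin (complex.Im z)).

Lemma cexpD z w : cexp (z + w) = cexp z * cexp w.
Proof.
case: z w => [a b] [c d]; rewrite /cexp /= expRD cosD sinD.
by apply/eqP; rewrite eq_complex /=; apply/andP; split; apply/eqP; ring.
Qed.

Lemma nbhs0_ReIm (P Q : R -> Prop) :
  (\forall x \near 0, P x) -> (\forall x \near 0, Q x) ->
  \forall z \near (0 : C^o), P (complex.Re z) /\ Q (complex.Im z).
Proof.
move=> P0 Q0; apply: filterI.
  by exact: (@continuous_Re R 0).
by exact: (@continuous_Im R 0).
Qed.

Lemma cexp_approx0 (e : R) : 0 < e -> \forall h \near (0 : C^o),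
  modulus (cexp h - 1 - h) <= e * modulus h.
Proof.
(* The real part of the remainder costs [3 * d * m] and the imaginary part [5 * d * m], whence the
   8. The bound [d <= 1] absorbs products of small quantities. *)
move=> e0; pose d := Num.min 1 (e / 8).
have d0 : 0 < d by rewrite lt_min ltr01 divr_gt0.
have d1 : d <= 1 by rewrite ge_min lexx.
have d8 : 8 * d <= e by rewrite mulrC -ler_pdivlMr // ge_min lexx orbT.
have He := @is_derive_approx _ _ _ _ (is_derive_expR (0 : R)) d0.
have Hc := @is_derive_approx _ _ _ _ (is_derive_cos (0 : R)) d0.
have Hs := @is_derive_approx _ _ _ _ (is_derive_sin (0 : R)) d0.
have Hd : \forall h \near (0 : R), `|h| <= d.
  by apply: filterS (nbhs0_lt d0) => h /ltW.
apply: (@filterS _ (nbhs (0 : C^o)) _ _ _ _ (nbhs0_ReIm (filterI He Hd) (filterI Hc Hs))).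
move=> [x y] /= [[]].
rewrite !addr0 expR0 mul1r cos0 sin0 oppr0 !mul0r mul1r !(subr0, addr0) => ex xd [cy sy].
apply: (@le_trans _ _ ((8 * d) * modulus (x +i* y))); last first.
  by rewrite ler_wpM2r ?modulus_ge0.
have xz := normr_Re_le (x +i* y); have yz := normr_Im_le (x +i* y).
rewrite /= in xz yz; set m := modulus (x +i* y) in xz yz *.
apply: le_trans (modulus_le_ReIm _) _; rewrite /= !mul0r !(oppr0, subr0, addr0).
have m0 : 0 <= m by exact: modulus_ge0.
have cos1 : `|cos y| <= 1 by rewrite ler_norml cos_geN1 cos_le1.
have dx : d * `|x| <= d * m by rewrite ler_wpM2l // ltW.
have dy : d * `|y| <= d * m by rewrite ler_wpM2l // ltW.
have dd : d * m <= m by rewrite ler_piMl.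
have A1 : `|expR x * cos y - 1 - x| <= 3 * d * m.
  have -> : expR x * cos y - 1 - x
    = (expR x - 1 - x) * cos y + (1 + x) * (cos y - 1) by ring.
  apply: le_trans (ler_normD _ _) _; rewrite !normrM.
  have B1 : `|expR x - 1 - x| * `|cos y| <= d * m.
    apply: le_trans dx; rewrite -[leRHS]mulr1.
    by apply: ler_pM => //.
  have B2 : `|1 + x| * `|cos y - 1| <= 2 * (d * m).
    apply: ler_pM => //; last exact: le_trans dy.
    by apply: le_trans (ler_normD _ _) _; rewrite normr1; lra.
  lra.
have A2 : `|expR x * sin y - y| <= 5 * d * m.
  have -> : expR x * sin y - y = (expR x - 1) * sin y + (sin y - y) by ring.
  apply: le_trans (ler_normD _ _) _; rewrite !normrM.
  have B1 : `|expR x - 1| <= 2 * d.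
    have -> : expR x - 1 = (expR x - 1 - x) + x by ring.
    apply: le_trans (ler_normD _ _) _.
    have : d * `|x| <= d * 1 by rewrite ler_wpM2l ?(ltW d0) // (le_trans xd).
    lra.
  have B2 : `|sin y| <= 2 * m.
    have -> : sin y = (sin y - y) + y by ring.
    by apply: le_trans (ler_normD _ _) _; lra.
  have := ler_pM (normr_ge0 _) (normr_ge0 _) B1 B2.
  have -> : 2 * d * (2 * m) = 4 * (d * m) by ring.
  lra.
have -> : 8 * d * m = 3 * d * m + 5 * d * m by ring.
exact: lerD.
Qed.

Lemma cexp_approx z (e : R) : 0 < e -> \forall h \near (0 : C^o),
  modulus (cexp (z + h) - cexp z - cexp z * h) <= e * modulus h.
Proof.
move=> e0; pose m := modulus (cexp z) + 1.
have m0 : 0 < m by rewrite ltr_wpDl ?modulus_ge0.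
apply: (@filterS _ (nbhs (0 : C^o)) _ _ _ _ (cexp_approx0 (divr_gt0 e0 m0))) => h H; rewrite cexpD.
have -> : cexp z * cexp h - cexp z - cexp z * h = cexp z * (cexp h - 1 - h) by ring.
rewrite modulusM; apply: (@le_trans _ _ (m * (e / m * modulus h))).
  by apply: ler_pM => //; rewrite ?modulus_ge0 // lerDl.
by rewrite mulrA [m * _]mulrC divfK ?gt_eqF.
Qed.

Lemma derivable_cexp z : derivable (cexp : C^o -> C^o) z 1.
Proof. by apply: (@derivable_complex_approx _ _ (cexp z)) => e e0; exact: cexp_approx. Qed.

(** * The principal logarithm and the principal power *)

Definition clog z : C := ln (modulus z) +i* Arg z.

Lemma Re_over_modulus z : z != 0 -> -1 <= complex.Re z / modulus z <= 1.
Proof.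
move=> z0; rewrite -ler_norml normrM normfV (ger0_norm (modulus_ge0 z)).
by rewrite ler_pdivrMr ?modulus_gt0 // mul1r normr_Re_le.
Qed.

Lemma modulusM_cos_Arg z : z != 0 -> modulus z * cos (Arg z) = complex.Re z.
Proof.
move=> z0.
have -> : cos (Arg z) = complex.Re z / modulus z.
  rewrite /Arg; case: ifP => _; rewrite ?cosN acosK // in_itv /= Re_over_modulus //.
by rewrite mulrC divfK // modulus_eq0.
Qed.

Lemma modulusM_sin_Arg z : z != 0 -> modulus z * sin (Arg z) = complex.Im z.
Proof.
move=> z0; have m0 : 0 < modulus z by rewrite modulus_gt0.
have sE : sin (acos (complex.Re z / modulus z)) = `|complex.Im z| / modulus z.
  rewrite sin_acos ?Re_over_modulus //.
  have -> : 1 - (complex.Re z / modulus z) ^+ 2 = (complex.Im z / modulus z) ^+ 2.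
    have := modulus_polar z; have := gt_eqF m0.
    move: (modulus z) (complex.Re z) (complex.Im z) => m a b m_neq0 E.
    have -> : (a / m) ^+ 2 = a ^+ 2 / m ^+ 2 by rewrite expr_div_n.
    rewrite expr_div_n; have -> : a ^+ 2 = m ^+ 2 - b ^+ 2 by rewrite -E; ring.
    by field; rewrite m_neq0.
  by rewrite sqrtr_sqr normrM normfV (gtr0_norm m0).
rewrite /Arg; case: ifPn => [i0|]; rewrite ?sinN sE.
  by rewrite ger0_norm // mulrC divfK // modulus_eq0.
rewrite -ltNge => i0; rewrite ltr0_norm // mulNr opprK mulrC divfK //.
by rewrite modulus_eq0.
Qed.

Lemma clogK z : z != 0 -> cexp (clog z) = z.
Proof.
move=> z0; rewrite /cexp /= lnK ?posrE ?modulus_gt0 //.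
apply/eqP; rewrite eq_complex /= !mul0r subr0 addr0.
by rewrite modulusM_cos_Arg // modulusM_sin_Arg // !eqxx.
Qed.

Lemma cpowE z x : z != 0 -> cpow z x = cexp (x%:C * clog z).
Proof.
move=> z0; rewrite /cpow /cexp ReM_real ImM_real /= /powR modulus_eq0.
by rewrite (negPf z0).
Qed.

(** [Arg] is defined by cases on the sign of the imaginary part, which hides its continuity across
    the positive real axis. On the right half-plane a single arcsine covers both cases. *)
Lemma Arg_asin z : 0 < complex.Re z -> Arg z = asin (complex.Im z / modulus z).
Proof.
move=> r0; have z0 : z != 0 by apply: contraTneq r0 => ->; rewrite ltxx.
rewrite -(modulusM_sin_Arg z0) mulrAC divff ?modulus_eq0 // mul1r sinK //.
have q0 : 0 < complex.Re z / modulus z by rewrite divr_gt0 ?modulus_gt0.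
have := Re_over_modulus z0; set q := _ / _ in q0 * => q1.
have qpi : acos q <= pi / 2.
  rewrite leNgt; apply/negP => lt.
  have : cos (acos q) <= cos (pi / 2).
    rewrite leNgt ltr_cos ?in_itv /= ?acos_ge0 ?acos_lepi //; last first.
      by rewrite divr_ge0 ?pi_ge0 //= ler_pdivrMr // ler_peMr ?pi_ge0 // ler1n.
    by rewrite -leNgt ltW.
  by rewrite acosK ?in_itv //= cos_pihalf leNgt q0.
have q0' : 0 <= acos q by exact: acos_ge0.
rewrite in_itv /= /Arg -/q; case: ifP => _; last by lra.
by rewrite qpi andbT; apply: le_trans q0'; rewrite oppr_le0 divr_ge0 ?pi_ge0.
Qed.

Lemma Re_gt0_near z : 0 < complex.Re z -> \forall w \near (z : C^o), 0 < complex.Re w.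
Proof.
by move=> r0; exact: cvgr_gt (@continuous_Re R z) _ r0.
Qed.

Lemma continuous_clog z : 0 < complex.Re z -> {for z, continuous (clog : C^o -> C^o)}.
Proof.
move=> r0; have z0 : z != 0 by apply: contraTneq r0 => ->; rewrite ltxx.
have mz : 0 < modulus z by rewrite modulus_gt0.
have cm : modulus w @[w --> (z : C^o)] --> modulus z.
  exact: continuous_modulus.
apply: cvg_complex; rewrite /=.
- exact: (@nbhs_filter C^o z).
- exact: cvg_comp _ _ cm (continuous_ln mz).
rewrite (Arg_asin r0).
apply: (@cvg_trans _ (asin (complex.Im w / modulus w) @[w --> (z : C^o)])).
  apply: (@near_eq_cvg _ _ (nbhs (z : C^o)) (@nbhs_filter C^o z)); near=> w; rewrite Arg_asin //.
  by near: w; exact: Re_gt0_near.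
apply: (@cvg_comp _ _ _ (fun w => complex.Im w / modulus w) (@asin R) _
  (nbhs (complex.Im z / modulus z))).
  apply: cvgM; [exact: (@nbhs_filter C^o z)|exact: continuous_Im|].
  by apply: cvgV => //; [exact: (@nbhs_filter C^o z)|rewrite gt_eqF].
apply: continuous_asin.
(* The argument of [asin] is in the open interval because [complex.Re z > 0] makes [|Im z| < |z|]
   strict. *)
rewrite -ltr_norml normrM normfV (gtr0_norm mz) ltr_pdivrMr // mul1r.
by rewrite modulus_sqrt -sqrtr_sqr ltr_sqrt ?ltrDr ?exprn_gt0 // ltr_wpDr ?sqr_ge0 ?exprn_gt0.
Unshelve. all: by end_near. Qed.

(* With [k = clog (z + h) - clog z], the differentiability of cexp gives
   [h = z k + o(k)], hence [k = h / z + o(h)]. *)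
Lemma derivable_clog z : 0 < complex.Re z -> derivable (clog : C^o -> C^o) z 1.
Proof.
move=> r0; have z0 : z != 0 by apply: contraTneq r0 => ->; rewrite ltxx.
have m0 : 0 < modulus z by rewrite modulus_gt0.
apply: (@derivable_complex_approx _ _ z^-1) => e e0.
(* The first bound lets [d |k|] be absorbed by [|z| |k|], giving [|k| <= 2 |h| / |z|]. The second
   then turns [d |k|] into at most [e |z| |h|], and the factor [|z|] cancels against the inverse. *)
pose d := Num.min (modulus z / 2) (e * modulus z ^+ 2 / 2).
have d0 : 0 < d by rewrite lt_min !divr_gt0 // mulr_gt0 // exprn_gt0.
have d1 : d <= modulus z / 2 by rewrite ge_min lexx.
have d2 : d <= e * modulus z ^+ 2 / 2 by rewrite ge_min lexx orbT.
have sh : (z + h : C^o) @[h --> (0 : C^o)] --> (z : C^o).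
  by rewrite -[X in _ --> X](addr0 (z : C^o)); exact: cvgD (cvg_cst _) cvg_id.
have kc : (clog (z + h) - clog z : C^o) @[h --> (0 : C^o)] --> (0 : C^o).
  rewrite -[X in _ --> X](subrr (clog z : C^o)).
  exact: cvgB (cvg_comp _ _ sh (continuous_clog r0)) (cvg_cst _).
have H : \forall h \near (0 : C^o),
    modulus (cexp (clog z + (clog (z + h) - clog z)) - cexp (clog z)
      - cexp (clog z) * (clog (z + h) - clog z)) <= d * modulus (clog (z + h) - clog z).
  exact: kc _ (@cexp_approx (clog z) d d0).
have P : \forall h \near (0 : C^o), 0 < complex.Re (z + h).
  exact: sh _ (Re_gt0_near r0).
apply: (@filterS _ (nbhs (0 : C^o)) _ _ _ _ (filterI H P)) => h [] /=.
rewrite [clog z + _]addrC subrK => {}H w0.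
have zh0 : z + h != 0 by apply: contraTneq w0 => ->; rewrite ltxx.
move: H; rewrite !clogK // [z + h]addrC addrK [h + z]addrC.
set k := clog (z + h) - clog z => H.
have kE : k - z^-1 * h = - (z^-1 * (h - z * k)) by rewrite mulrBr mulKf // opprB.
rewrite kE modulusN modulusM modulusV mulrC ler_pdivrMr //.
apply: (le_trans H).
have zk : modulus z * modulus k <= modulus h + d * modulus k.
  rewrite -modulusM -[z * k](subKr h); apply: le_trans (ler_modulusB _ _) _.
  by rewrite lerD2l; exact: H.
have kh : modulus k * (modulus z / 2) <= modulus h.
  have := ler_wpM2r (modulus_ge0 k) d1; move: zk; clear.
  move: (modulus k) (modulus z) (modulus h) => a b cc; nra.
apply: le_trans (ler_wpM2r (modulus_ge0 k) d2) _.
have -> : e * modulus z ^+ 2 / 2 * modulus k = e * modulus z * (modulus k * (modulus z / 2)).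
  by field.
have -> : e * modulus h * modulus z = e * modulus z * modulus h by ring.
by rewrite ler_wpM2l // mulr_ge0 // ltW.
Qed.

Lemma derivable_cpow z x : 0 < complex.Re z ->
  derivable ((fun w => cpow w x) : C^o -> C^o) z 1.
Proof.
move=> r0.
have : derivable ((fun w => cexp (x%:C * clog w)) : C^o -> C^o) z 1.
  have D1 : differentiable ((fun w => x%:C * clog w) : C^o -> C^o) (z : C^o).
    by apply/derivable1_diffP/derivableM; [exact: derivable_cst|exact: derivable_clog].
  have D2 : differentiable (cexp : C^o -> C^o) (x%:C * clog z : C^o).
    exact/derivable1_diffP/derivable_cexp.
  exact/derivable1_diffP/(differentiable_comp D1 D2).
apply: near_eq_derivable; near=> w; rewrite cpowE //.
have : 0 < complex.Re w by near: w; exact: Re_gt0_near.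
by apply: contraTneq => ->; rewrite ltxx.
Unshelve. all: by end_near. Qed.

End ComplexPower.

(** * Compact operators on weighted spaces *)

Section WeightedSpaces.
Variables (R : realType) (u : R[i] -> R).
Hypothesis u_gt0 : forall z, disk z -> 0 < u z.
Local Notation C := R[i].
Implicit Types (f g : C -> C) (z : C).

Lemma disk0 : disk (0 : C).
Proof. by rewrite /disk /= modulus0. Qed.

Lemma unorm_leP f (M : R) :
  (unorm u f <= M%:E)%E <-> forall z, disk z -> modulus (f z) * u z <= M.
Proof.
split=> [H z zD|H].
  rewrite -lee_fin; apply: le_trans H.
  by apply: ereal_sup_ubound; exists z.
by apply: ge_ereal_sup => _ [z zD <-]; rewrite lee_fin H.
Qed.

Lemma unorm_lt f (e : R) z : (unorm u f < e%:E)%E -> disk z -> modulus (f z) * u z < e.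
Proof.
move=> H zD; rewrite -lte_fin; apply: le_lt_trans H.
by apply: ereal_sup_ubound; exists z.
Qed.

Lemma unorm_ge0 f : (0 <= unorm u f)%E.
Proof.
apply: le_ereal_sup_tmp; exists (modulus (f 0) * u 0)%:E; first by exists 0 => //; exact: disk0.
by rewrite lee_fin mulr_ge0 ?modulus_ge0 // ltW // u_gt0 //; exact: disk0.
Qed.

Lemma holomorphic_cst (a : C) : holomorphic (fun _ => a).
Proof. by move=> z _; exact: derivable_cst. Qed.

Lemma holomorphicD f g : holomorphic f -> holomorphic g ->
  holomorphic (fun z => f z + g z).
Proof. by move=> fh gh z zD; apply: derivableD; [exact: fh|exact: gh]. Qed.

Lemma holomorphicM f g : holomorphic f -> holomorphic g ->
  holomorphic (fun z => f z * g z).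
Proof. by move=> fh gh z zD; apply: derivableM; [exact: fh|exact: gh]. Qed.

Lemma holomorphic_id : holomorphic (fun z : C => z).
Proof. by move=> z _; exact: (@derivable_id _ C^o). Qed.

Lemma holomorphicX n : holomorphic (fun z : C => z ^+ n).
Proof.
elim: n => [|n IH]; first exact: holomorphic_cst.
suff -> : (fun z : C => z ^+ n.+1) = (fun z => z * z ^+ n).
  exact: holomorphicM holomorphic_id IH.
by apply/funext => z; rewrite exprS.
Qed.

Lemma to_circle_filter : Filter (@to_circle R).
Proof.
apply: filter_from_filter; first by exists 0 => /=.
move=> r s /= r1 s1; exists (Num.max r s) => /=; first by rewrite gt_max r1 s1.
by move=> z /= /andP[]; rewrite gt_max => /andP[-> ->] ->.
Qed.

Lemma H0_uP f : H0_u u f <-> [/\ holomorphic f,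
  exists M : R, forall z, disk z -> modulus (f z) * u z <= M &
  forall e : R, 0 < e -> exists2 rho : R, rho < 1 &
    forall z, rho < modulus z < 1 -> modulus (f z) * u z < e].
Proof.
have TF := to_circle_filter.
split.
  case=> -[fh fn] fl; split => //.
    have : unorm u f \is a fin_num.
      by rewrite ge0_fin_numE ?unorm_ge0.
    by move=> /fineK E; exists (fine (unorm u f)); apply/unorm_leP; rewrite E.
  move=> e e0; have [rho /= rho1 H] := (cvgr0Pnorm_lt _).1 fl _ e0.
  exists rho => // z zr; have /= := H z zr; apply: le_lt_trans; exact: ler_norm.
case=> fh [M HM] H; split.
  split => //; apply: (@le_lt_trans _ _ M%:E); last exact: ltry.
  exact/unorm_leP.
apply/cvgr0Pnorm_lt => e e0; have [rho rho1 Hr] := H e e0.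
exists rho => //= z zr; rewrite ger0_norm ?Hr // mulr_ge0 ?modulus_ge0 //.
by rewrite ltW // u_gt0 //; case/andP: zr.
Qed.

Lemma H0_u_lincomb (a : C) f g : H0_u u f -> H0_u u g ->
  H0_u u (fun z => a * f z + g z).
Proof.
move=> /H0_uP[fh [M HM] fl] /H0_uP[gh [N HN] gl]; apply/H0_uP.
have m0 := modulus_ge0 a.
have B z : disk z -> modulus (a * f z + g z) * u z <=
    modulus a * (modulus (f z) * u z) + modulus (g z) * u z.
  move=> zD; rewrite mulrA -modulusM -mulrDl ler_wpM2r ?ler_modulusD //.
  exact/ltW/u_gt0.
split.
- exact: (holomorphicD (holomorphicM (@holomorphic_cst a) fh) gh).
- exists (modulus a * M + N) => z zD; apply: le_trans (B z zD) _.
  by rewrite lerD ?HN // ler_wpM2l // HM.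
- move=> e e0; pose d := e / (modulus a + 1).
  have a1 : 0 < modulus a + 1 by rewrite ltr_wpDl.
  have d0 : 0 < d by rewrite divr_gt0.
  have [r r1 Hr] := fl _ d0; have [s s1 Hs] := gl _ d0.
  exists (Num.max r s); first by rewrite gt_max r1 s1.
  move=> z /andP[]; rewrite gt_max => /andP[rz sz] z1.
  have zD : disk z by [].
  apply: le_lt_trans (B z zD) _.
  have -> : e = modulus a * d + d by rewrite -[X in _ + X]mul1r -mulrDl mulrC divfK ?gt_eqF.
  rewrite ler_ltD //; last by rewrite Hs // sz.
  by rewrite ler_wpM2l // ltW // Hr // rz.
Qed.

Lemma H0_u0 : H0_u u (fun _ => 0).
Proof.
apply/H0_uP; split; first exact: holomorphic_cst.
- by exists 0 => z _; rewrite modulus0 mul0r.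
- by move=> e e0; exists 0 => // z _; rewrite modulus0 mul0r.
Qed.

(** * Compact operators and the gliding hump *)

Lemma homo_ltn_ge (s : nat -> nat) : {homo s : m n / (m < n)%N} -> forall k, (k <= s k)%N.
Proof. by move=> sm; elim=> // k IH; apply: leq_ltn_trans IH (sm _ _ _). Qed.

Lemma cvge_lt_near {T : Type} (G : set_system T) (f : T -> \bar R) :
  f @ G --> 0%E -> forall e : R, 0 < e -> \forall k \near G, (f k < e%:E)%E.
Proof. by move=> f0 e e0; apply: (f0 [set x | (x < e%:E)%E]); exact: open_ereal_lt'. Qed.

(** Otherwise some [F k] in the unit ball have [|L (F k) z| > k]. Along a subsequence whose images
    converge to [h], the values at [z] are eventually at most [|h z| + 1 / u z], the constant [B]
    below. *)
Lemma compact_op_pointwise_bounded (X : set (C -> C)) L z : compact_op u X L -> disk z ->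
  exists M : R, forall f, X f -> (unorm u f <= 1)%E -> modulus (L f z) <= M.
Proof.
case=> LX Llin Lc zD; apply: contrapT => /forallNP nb.
have /choice[F HF] : forall k : nat, exists f,
    [/\ X f, (unorm u f <= 1)%E & k%:R < modulus (L f z)].
  move=> k; apply: contrapT => /forallNP nf; apply: (nb k%:R) => f Xf f1.
  by rewrite leNgt; apply/negP => H; exact: (nf f).
have [k|s [h [sm hH /cvge_lt_near H]]] := Lc F; first by case: (HF k).
have uz := u_gt0 zD.
pose B := modulus (h z) + (u z)^-1.
have B0 : 0 <= B by rewrite addr_ge0 ?modulus_ge0 // invr_ge0 ltW.
have [k [/unorm_lt/(_ zD) k1 kB]] : exists k : nat,
    (unorm u (fun w => (L (F (s k)) w - h w)%R) < 1%:E)%E /\ (Num.bound B <= k)%N.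
  have : \forall k \near \oo, (unorm u (fun w => (L (F (s k)) w - h w)%R) < 1%:E)%E /\
      (Num.bound B <= k)%N by apply: filterI; [exact: H|exact: nbhs_infty_ge].
  by move=> /filter_ex.
have [_ _] := HF (s k); apply/negP; rewrite -leNgt.
apply: (@le_trans _ _ B); last first.
  apply: le_trans (ltW (archi_boundP B0)) _.
  by rewrite ler_nat (leq_trans kB) // homo_ltn_ge.
rewrite -[L _ z](subrK (h z)) addrC; apply: le_trans (ler_modulusD _ _) _.
by rewrite lerD2l // -div1r ler_pdivlMr // ltW.
Qed.

(* Gliding hump: [F k] is small on compact subsets of the disk for large [k] and
   near the circle for fixed [k], so sparse sums of the [F (s k)] stay in the
   ball of radius 2, whereas their images under [L] grow like multiples of [h]. *)
Lemma compact_op_limit_eq0 (X : set (C -> C)) L (F : nat -> C -> C)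
    (s : nat -> nat) (h : C -> C) z :
  H0_u u `<=` X -> compact_op u X L ->
  (forall k, H0_u u (F k)) ->
  (forall k w, disk w -> modulus (F k w) * u w <= modulus w ^+ k) ->
  {homo s : m n / (m < n)%N} ->
  unorm u (fun w => L (F (s k)) w - h w) @[k --> \oo] --> 0%E ->
  disk z -> h z = 0.
Proof.
move=> HX Lc F0 FX sm /cvge_lt_near Fh zD.
have [M HM] := compact_op_pointwise_bounded Lc zD.
have [_ Llin _] := Lc.
have L0 : L (fun _ => 0) z = 0.
  have := Llin 1 _ _ (HX _ H0_u0) (HX _ H0_u0) z zD.
  have -> : (fun _ : C => 1 * 0 + 0) = (fun _ => 0 : C) by apply/funext => w; rewrite mulr0 addr0.
  by move=> E; apply: (addIr (L (fun _ => 0) z)); rewrite add0r {3}E mul1r.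
apply/eqP; rewrite -modulus_eq0; apply: contraT => hz; pose m := modulus (h z).
have m0 : 0 < m by rewrite lt0r hz modulus_ge0.
have uz := u_gt0 zD.
(* [S] is a sum of [N] humps. The bound [2 - 2^-N] leaves [2^-(N+1)] for the next hump, and each
   hump contributes [h z] to [L S z] up to an error [m / 2], so [|L S z|] is at least [N m / 2]. *)
have step : forall N : nat, exists S, [/\ H0_u u S,
    forall w, disk w -> modulus (S w) * u w <= 2 - 2^-1 ^+ N
  & modulus (L S z - N%:R * h z) <= N%:R * (m / 2)].
  elim=> [|N [S [S0 SN LS]]].
    exists (fun _ => 0); split; first exact: H0_u0.
      by move=> w wD; rewrite modulus0 mul0r expr0; lra.
    by rewrite L0 !mul0r subrr modulus0.
  have [_ _ Sl] := (H0_uP _).1 S0.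
  have e0 : 0 < 2^-1 ^+ N.+1 :> R by rewrite exprn_gt0 // invr_gt0.
  have [rho rho1 Srho] := Sl _ e0.
  (* Outside radius [r] the old sum is below [2^-(N+1)] and the new hump at most 1; inside, the new
     hump is below [2^-(N+1)] once [r ^+ k] is. The maximum with 0 keeps the base of this power
     nonnegative. *)
  pose r := Num.max rho 0.
  have r0 : 0 <= r by rewrite le_max lexx orbT.
  have r1 : r < 1 by rewrite gt_max rho1 ltr01.
  have [k [/unorm_lt/(_ zD) k1 k2]] : exists k : nat,
      (unorm u (fun w => (L (F (s k)) w - h w)%R) < (m / 2 * u z)%:E)%E /\
      r ^+ k < 2^-1 ^+ N.+1.
    have : \forall k \near \oo, (unorm u (fun w => (L (F (s k)) w - h w)%R) < (m / 2 * u z)%:E)%E /\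
        r ^+ k < 2^-1 ^+ N.+1.
      apply: filterI; first by apply: Fh; rewrite mulr_gt0 // divr_gt0.
      have : r ^+ k @[k --> \oo] --> (0 : R) by apply: cvg_expr; rewrite ger0_norm.
      by move/cvgr_lt; apply.
    by move=> /filter_ex.
  exists (fun w => 1 * F (s k) w + S w); split.
  - exact: H0_u_lincomb.
  - move=> w wD; have uw := u_gt0 wD.
    have B1 : modulus (1 * F (s k) w + S w) * u w <=
        modulus (F (s k) w) * u w + modulus (S w) * u w.
      by rewrite mul1r -mulrDl ler_wpM2r ?ler_modulusD // ltW.
    apply: le_trans B1 _.
    have E : 2^-1 ^+ N = 2 * 2^-1 ^+ N.+1 :> R by rewrite exprS mulrA divff ?mul1r.
    have E1 : 2^-1 ^+ N <= 1 :> R.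
      by apply: exprn_ile1; [rewrite invr_ge0|rewrite invf_le1 // ler1n].
    have [wr|rw] := leP (modulus w) r.
      have B2 := SN w wD.
      have B3 : modulus (F (s k) w) * u w <= 2^-1 ^+ N.+1.
        apply: le_trans (FX (s k) w wD) _.
        apply: (@le_trans _ _ (r ^+ s k)); first by rewrite lerXn2r ?nnegrE ?modulus_ge0.
        apply: le_trans (ltW k2); apply: ler_wiXn2l => //; first exact: ltW.
        exact: homo_ltn_ge.
      lra.
    have B2 : modulus (S w) * u w < 2^-1 ^+ N.+1.
      by apply: Srho; rewrite wD andbT; apply: le_lt_trans rw; rewrite le_max lexx.
    have B3 : modulus (F (s k) w) * u w <= 1.
      apply: le_trans (FX (s k) w wD) _.
      by apply: exprn_ile1; [exact: modulus_ge0|exact: ltW].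
    lra.
  - rewrite Llin //; try exact: HX.
    have -> : 1 * L (F (s k)) z + L S z - N.+1%:R * h z
       = (L (F (s k)) z - h z) + (L S z - N%:R * h z) by rewrite -natr1; ring.
    apply: le_trans (ler_modulusD _ _) _.
    rewrite -natr1 mulrDl mul1r addrC lerD // ltW //.
    by rewrite -(ltr_pM2r uz).
have M0 : 0 <= 4 * M / m.
  rewrite divr_ge0 ?(ltW m0) // mulr_ge0 //.
  apply: le_trans (HM _ (HX _ H0_u0) _); first by rewrite modulus_ge0.
  by apply/unorm_leP => w _; rewrite modulus0 mul0r.
(* [S / 2] is in the unit ball, so [|L S z| <= 2 M], against [|L S z| >= N m / 2]; this fails for
   [N > 4 M / m]. *)
have [S [S0 SN LS]] := step (Num.bound (4 * M / m)).
have := archi_boundP M0.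
move: LS SN; move: (Num.bound _) => N LS SN.
rewrite ltr_pdivrMr // => NM.
have := HM _ (HX _ (H0_u_lincomb 2^-1 S0 H0_u0)) _.
rewrite Llin //; try exact: (HX _ H0_u0); try exact: HX.
rewrite L0 addr0 modulusM.
have m2 : modulus (2^-1 : C) = 2^-1.
  by rewrite modulusV -[2 : C](rmorph_nat (real_complex R)) modulus_real ger0_norm.
rewrite m2 => H; have {}H : 2^-1 * modulus (L S z) <= M.
  apply: H; apply/unorm_leP => w wD; rewrite addr0 modulusM m2 -mulrA.
  have e0 : 0 < 2^-1 ^+ N :> R by rewrite exprn_gt0 // invr_gt0.
  by have := SN w wD; lra.
have NH : N%:R * m <= modulus (L S z) + N%:R * (m / 2).
  have -> : N%:R * m = modulus (N%:R * h z).
    by rewrite modulusM -[N%:R : C](rmorph_nat (real_complex R)) modulus_real ger0_norm.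
  rewrite -[N%:R * h z](subKr (L S z)); apply: le_trans (ler_modulusB _ _) _.
  by rewrite lerD2l.
move: NM H NH; clear; lra.
Qed.

(** Compactness yields some limit [h] of a subsequence of the images, and the preceding lemma leaves
    only [h = 0] on the disk. *)
Lemma compact_op_cvg0 (X : set (C -> C)) L (F : nat -> C -> C) :
  H0_u u `<=` X -> compact_op u X L ->
  (forall k, H0_u u (F k)) ->
  (forall k w, disk w -> modulus (F k w) * u w <= modulus w ^+ k) ->
  exists2 s : nat -> nat, {homo s : m n / (m < n)%N} &
    forall e : R, 0 < e -> \forall k \near \oo,
      forall w, disk w -> modulus (L (F (s k)) w) * u w < e.
Proof.
move=> HX Lc F0 FX; have [_ _ Lcc] := Lc.
have [k|s [h [sm _ Fh]]] := Lcc F.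
  split; first exact: HX.
  apply/unorm_leP => w wD; apply: le_trans (FX k w wD) _.
  by apply: exprn_ile1; [exact: modulus_ge0|exact: ltW].
exists s => // e e0; apply: filterS (cvge_lt_near Fh e0) => k /unorm_lt Hk w wD.
by have := Hk w wD; rewrite (compact_op_limit_eq0 HX Lc F0 FX sm Fh wD) subr0.
Qed.

End WeightedSpaces.

(** * Test functions *)

Section TestFunctions.
Variable R : realType.
Local Notation C := R[i].

Lemma modulus_cpow (z : C) c : modulus (cpow z c) = modulus z `^ c.
Proof.
rewrite /cpow modulusM modulus_real ger0_norm ?powR_ge0 //.
by rewrite [X in _ * X]modulus_sqrt /= cos2Dsin2 sqrtr1 mulr1.
Qed.

(** Since [|1 - z| <= 2] and [ln 2 <= 1], it follows from [1 - c <= 1 - c ln 2 <= exp (- c ln 2)].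
    For [c >= 1] the left side is nonpositive. *)
Lemma ler_modulus_cpow_disk (z : C) c : 0 <= c -> disk z ->
  (1 - c) * modulus (cpow (1 - z) c) <= 1.
Proof.
move=> c0 zD; rewrite modulus_cpow.
have z2 : modulus (1 - z) `^ c <= 2 `^ c.
  apply: ge0_ler_powR; rewrite ?nnegrE ?modulus_ge0 //.
  apply: le_trans (ler_modulusB _ _) _; rewrite modulus1.
  by have : modulus z < 1 by []; lra.
have [c1|c1] := leP 1 c.
  apply: (@le_trans _ _ 0) => //.
  by rewrite mulr_le0_ge0 ?powR_ge0 // subr_le0.
apply: (@le_trans _ _ ((1 - c) * 2 `^ c)); first by rewrite ler_wpM2l // subr_ge0 ltW.
have ln2 : ln 2 <= 1 :> R by have := @le_ln1Dx R 1; apply; lra.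
have -> : 2 `^ c = expR (c * ln 2) :> R by rewrite /powR pnatr_eq0.
rewrite -ler_pdivlMr ?expR_gt0 // mul1r -expRN.
have := @expR_ge1Dx R (- (c * ln 2)); apply: le_trans.
by rewrite lerD2l lerN2 ler_piMr.
Qed.

(** Compactness of the circle turns local statements at each boundary point into a uniform one on an
    annulus: counterexamples with modulus tending to 1 would cluster at some [zeta] of modulus 1,
    near which [P] holds. *)
Lemma to_circle_local (P : C -> Prop) :
  (forall zeta : C, modulus zeta = 1 ->
    exists2 e : R, 0 < e & forall z, modulus (zeta - z) < e -> disk z -> P z) ->
  exists2 rho : R, rho < 1 & forall z, rho < modulus z < 1 -> P z.
Proof.
move=> HP; apply: contrapT => nP.
have /choice[s Hs] : forall k : nat, exists z : C, [/\ 1 - k.+1%:R^-1 < modulus z, disk z & ~ P z].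
  move=> k; apply: contrapT => /forallNP H; apply: nP; exists (1 - k.+1%:R^-1).
    by rewrite ltrBlDr ltrDl invr_gt0.
  move=> z /andP[z1 z2]; apply: contrapT => nPz; exact: (H z).
(* The sequence is read in [R * R], where the square is compact as a product of segments. *)
pose q k : R * R := (complex.Re (s k), complex.Im (s k)).
have cK := compact_setX (@segment_compact R (-1) 1) (@segment_compact R (-1) 1).
have qK : (q @ \oo) (`[-1, 1] `*` `[-1, 1])%classic.
  exists 0%N => // k _ /=; have [_ sD _] := Hs k.
  by rewrite !in_itv /= -!ler_norml; split; apply: le_trans (ltW sD);
    [exact: normr_Re_le|exact: normr_Im_le].
have [[a b] [_ Hcl]] := cK (q @ \oo) _ qK.
pose zeta : C := a +i* b.
(* A cluster point is approached at arbitrarily late indices; this suffices without extracting a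
   subsequence. *)
have pick N e : 0 < e -> exists2 k, (N <= k)%N & modulus (zeta - s k) < e.
  move=> e0; have [] := Hcl (q @` [set k | (N <= k)%N])
      [set p | modulus (zeta - (p.1 +i* p.2)) < e].
  - by exists N => // k /= Nk; exists k.
  - have : ((p.1 +i* p.2 : C^o) @[p --> ((a, b) : R * R)] --> (zeta : C^o)).
      apply: cvg_complex => /=; [exact: cvg_fst|exact: cvg_snd].
    by move/cvg_modulusP => /(_ _ e0).
  - move=> _ [[k /= Nk <-]] /= H; exists k => //.
    by move: H; rewrite /q /=; case: (s k).
have zeta1 : modulus zeta = 1.
  apply/eqP; rewrite -subr_eq0 -normr_le0; apply/ler_addgt0Pl => e e0; rewrite addr0.
  have e2 : 0 < e / 2 by rewrite divr_gt0.
  have [k Nk Hk] := pick (Num.bound (e / 2)^-1) _ e2.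
  have [s1 sD _] := Hs k; rewrite /disk /= in sD.
  have k1 : k.+1%:R^-1 <= e / 2 :> R.
    rewrite -[e / 2]invrK lef_pV2 ?posrE ?invr_gt0 //.
    apply: le_trans (ltW (archi_boundP _)) _; first by rewrite invr_ge0 ltW.
    by rewrite ler_nat (leq_trans Nk).
  have H1 : modulus zeta <= modulus (s k) + e / 2.
    by rewrite -[zeta](subrK (s k)) addrC (le_trans (ler_modulusD _ _)) // lerD2l ltW.
  have H2 : modulus (s k) <= modulus zeta + e / 2.
    rewrite -[s k](subKr zeta); apply: le_trans (ler_modulusB _ _) _.
    by rewrite lerD2l ltW.
  rewrite ler_norml; apply/andP; move: H1 H2 s1 sD k1.
  move: (k.+1%:R^-1) (modulus (s k)) (modulus zeta); clear => x y z.
  by split; lra.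
have [e e0 He] := HP _ zeta1; have [k _ Hk] := pick 0%N _ e0.
by have [_ sD nPs] := Hs k; exact: nPs (He _ Hk sD).
Qed.

Lemma limf_einf_lt {T : choiceType} {X : filteredType T} (f : X -> \bar R)
    (F : set (set X)) (b : \bar R) :
  (b < limf_einf f F)%E -> exists2 V, F V & forall x, V x -> (b < f x)%E.
Proof.
rewrite limf_einfE => /ereal_sup_gt[_ [V FV <-] H]; exists V => // x Vx.
by apply: lt_le_trans H _; apply: ereal_inf_lbound; exists x.
Qed.

Lemma limf_einf_ge {T : choiceType} {X : filteredType T} (f : X -> \bar R)
    (F : set (set X)) (V : set X) (b : \bar R) :
  F V -> (forall x, V x -> (b <= f x)%E) -> (b <= limf_einf f F)%E.
Proof.
rewrite limf_einfE => FV H; apply: le_ereal_sup_tmp; exists (ereal_inf (f @` V)); first by exists V.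
by apply: le_ereal_inf_tmp => _ [x Vx <-]; exact: H.
Qed.

Variables (u : C -> R) (g : C -> C).
Hypothesis u_gt0 : forall z, disk z -> 0 < u z.
Hypothesis g_test : is_test_function u g.

Lemma ler_modulus_test_f c n z : 0 <= c < 1 -> disk z ->
  modulus ((1 - c)%:C * test_f g c n z) * u z <= modulus z ^+ n.
Proof.
move=> /andP[c0 c1] zD; have [_ /unorm_leP gu _ _] := g_test.
rewrite /test_f 2!modulusM [modulus (z ^+ n * g z)]modulusM modulusX modulus_real ger0_norm;
    last by rewrite subr_ge0 ltW.
have A := ler_modulus_cpow_disk c0 zD; have B := gu z zD.
set p := modulus (cpow _ _) in A *; set m := _ ^+ n.
have -> : (1 - c) * (m * modulus (g z) * p) * u z =
    m * (((1 - c) * p) * (modulus (g z) * u z)) by ring.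
rewrite ler_piMr ?exprn_ge0 ?modulus_ge0 // -[leRHS]mulr1; apply: ler_pM => //.
  by rewrite mulr_ge0 ?modulus_ge0 // subr_ge0 ltW.
by rewrite mulr_ge0 ?modulus_ge0 // ltW // u_gt0.
Qed.

Lemma holomorphic_test_f c n : holomorphic (test_f g c n).
Proof.
have [gh _ _ _] := g_test.
have ph : holomorphic (fun z => cpow (1 - z) c).
  move=> z zD.
  have D1 : differentiable ((fun w => 1 - w) : C^o -> C^o) (z : C^o).
    by apply/derivable1_diffP/derivableB; [exact: derivable_cst|exact: (@derivable_id _ C^o)].
  have D2 : differentiable ((fun w => cpow w c) : C^o -> C^o) (1 - z : C^o).
    apply/derivable1_diffP/derivable_cpow.
    rewrite (raddfB (@complex.Re R : Rcomplex R -> R)) /= subr_gt0.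
    by apply: le_lt_trans (ler_norm _) _; apply: le_lt_trans (normr_Re_le z) _.
  exact/derivable1_diffP/(differentiable_comp D1 D2).
exact: (holomorphicM (holomorphicM (@holomorphicX R n) gh) ph).
Qed.

(** Decay at the boundary has two sources: at 1 the power [|1 - z|^c] vanishes while [|g| u <= 1];
    at every other boundary point [|g| u] vanishes while the remaining factors are at most 1. *)
Lemma H0_u_test_f c n : 0 < c < 1 -> H0_u u (fun z => (1 - c)%:C * test_f g c n z).
Proof.
move=> /andP[c0 c1].
have c01 : 0 <= c < 1 by rewrite ltW.
apply/H0_uP => //; split.
- exact: (holomorphicM (@holomorphic_cst R (1 - c)%:C) (@holomorphic_test_f c n)).
- exists 1 => z zD; apply: le_trans (ler_modulus_test_f n c01 zD) _.
  by apply: exprn_ile1; [exact: modulus_ge0|exact: ltW].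
move=> e e0; apply: to_circle_local => zeta zeta1.
have [_ /unorm_leP gu glim _] := g_test.
have zn z : disk z -> modulus z ^+ n <= 1.
  by move=> zD; apply: exprn_ile1; [exact: modulus_ge0|exact: ltW].
have fE z : modulus ((1 - c)%:C * test_f g c n z) * u z =
    modulus z ^+ n * ((1 - c) * modulus (cpow (1 - z) c) * (modulus (g z) * u z)).
  rewrite /test_f 2!modulusM [modulus (z ^+ n * g z)]modulusM modulusX modulus_real ger0_norm;
    last by rewrite subr_ge0 ltW.
  ring.
have gu0 z : disk z -> 0 <= modulus (g z) * u z.
  by move=> zD; rewrite mulr_ge0 ?modulus_ge0 // ltW // u_gt0.
have p0 z : 0 <= (1 - c) * modulus (cpow (1 - z) c).
  by rewrite mulr_ge0 ?modulus_ge0 // subr_ge0 ltW.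
have zn0 z : 0 <= modulus z ^+ n by rewrite exprn_ge0 ?modulus_ge0.
have [->|zeta_neq1] := eqVneq zeta 1.
  (* Within this distance of 1, [|1 - z|^c] is below [Num.min e 1]; here [c > 0] is essential. *)
  exists (Num.min e 1 `^ c^-1).
    by rewrite powR_gt0 // lt_min e0 ltr01.
  move=> z z1 zD; rewrite fE.
  apply: (@le_lt_trans _ _ ((1 - c) * modulus (cpow (1 - z) c))).
    rewrite -[leRHS]mul1r; apply: ler_pM; [exact: zn0| |exact: zn|].
      by rewrite mulr_ge0 ?p0 ?gu0.
    by rewrite ler_piMr ?p0 // gu.
  apply: (@le_lt_trans _ _ (modulus (1 - z) `^ c)).
    by rewrite modulus_cpow ler_piMl ?powR_ge0 // lerBlDr lerDl ltW.
  apply: (@lt_le_trans _ _ ((Num.min e 1 `^ c^-1) `^ c)).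
    by apply: gt0_ltr_powR; rewrite ?nnegrE ?modulus_ge0 ?powR_ge0.
  rewrite -powRrM mulVf ?gt_eqF // powRr1 ?ge_min ?lexx //.
  by rewrite le_min ler01 ltW.
have := glim zeta zeta1 zeta_neq1; rewrite limf_esupE => gl0.
have : (ereal_inf [set ereal_sup ((fun z => (modulus (g z) * u z)%:E) @` V) |
    V in within (@disk R) (nbhs (zeta : C^o))] < e%:E)%E by rewrite gl0 lte_fin.
move=> /ereal_inf_lt[_ [V VF <-] Ve].
have /nbhs_modulusP[d d0 Hd] := VF.
exists d => // z zd zD; rewrite fE.
have ge : modulus (g z) * u z < e.
  rewrite -lte_fin; apply: le_lt_trans Ve; apply: ereal_sup_ubound.
  by exists z => //; exact: Hd.
apply: le_lt_trans ge.
rewrite -[leRHS]mul1r; apply: ler_pM; [exact: zn0| |exact: zn|].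
  by rewrite mulr_ge0 ?p0 ?gu0.
by rewrite ler_piMl ?gu0 // ler_modulus_cpow_disk // ltW.
Qed.

End TestFunctions.

(** * The change of variables x = phi_t(r) *)

Section Integrals.
Variable R : realType.
Local Notation C := R[i].
Local Notation mu := (@lebesgue_measure R).
Local Notation U01 := (`]0, 1[%classic : set R).

(* The integral of a nonnegative function is by definition a supremum over the
   simple functions below it, measurable or not. *)
Lemma ge0_le_integral_nomeas (D : set R) (f g : R -> \bar R) :
  (forall x, D x -> (0 <= f x)%E) -> (forall x, D x -> (f x <= g x)%E) ->
  (\int[mu]_(x in D) f x <= \int[mu]_(x in D) g x)%E.
Proof.
move=> f0 fg; have g0 x : D x -> (0 <= g x)%E by move=> Dx; exact: le_trans (f0 _ Dx) (fg _ Dx).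
rewrite !ge0_integralE //; apply: ereal_sup_le => _ [h hf <-]; exists h => // x.
apply: le_trans (hf x) _; rewrite /patch; case: ifPn => // /[!inE]; exact: fg.
Qed.

(** [phi] at a real point, with the arguments exchanged: the substitution fixes [r] and varies [t],
    and [drphi] is the derivative in [t]. *)
Definition rphi (r t : R) : R := t / ((t - 1) * r + 1).
Definition drphi (r t : R) : R := (1 - r) / ((t - 1) * r + 1) ^+ 2.

Section Substitution.
Variable r : R.
Hypothesis r01 : 0 < r < 1.

Lemma rphi_den_gt0 (t : R) : 0 <= t -> 0 < (t - 1) * r + 1.
Proof. by move=> t0; case/andP: r01 => r0 r1; nra. Qed.

Lemma drphi_gt0 (t : R) : 0 <= t -> 0 < drphi r t.
Proof.
by move=> t0; rewrite divr_gt0 ?exprn_gt0 ?rphi_den_gt0 // subr_gt0; case/andP: r01.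
Qed.

Lemma is_derive_rphi (t : R) : 0 <= t -> is_derive t 1 (rphi r) (drphi r t).
Proof.
move=> t0; have d0 : (t - 1) * r + 1 != 0 by rewrite gt_eqF ?rphi_den_gt0.
have D1 : is_derive t (1 : R) (fun s => (s - 1) * r + 1) r.
  have -> : (fun s : R => (s - 1) * r + 1) = (r \*: (@id R)) + cst (1 - r).
    by apply/funext => s; rewrite !fctE /= /cst /GRing.scale /=; ring.
  by apply: is_derive_eq; rewrite addr0 /GRing.scale /= mulr1.
have D2 : is_derive t (1 : R) (fun s => ((s - 1) * r + 1)^-1) (- ((t - 1) * r + 1) ^- 2 *: r).
  exact: is_deriveV.
have -> : rphi r = (@id R) * (fun s => ((s - 1) * r + 1)^-1) by [].
apply: is_derive_eq; rewrite /drphi /GRing.scale /=.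
by field.
Qed.

Lemma continuous_rphi (t : R) : 0 <= t -> {for t, continuous (rphi r)}.
Proof.
move=> t0; apply/differentiable_continuous/derivable1_diffP.
by have [] := is_derive_rphi t0.
Qed.

Lemma continuous_drphi (t : R) : 0 <= t -> {for t, continuous (drphi r)}.
Proof.
move=> t0; apply: cvgM; first exact: cvg_cst.
apply: cvgV; first by rewrite expf_neq0 // gt_eqF ?rphi_den_gt0.
have c : (s - 1) * r + 1 @[s --> t] --> (t - 1) * r + 1.
  by apply: cvgD; [apply: cvgMl; apply: cvgB; [exact: cvg_id|exact: cvg_cst]|exact: cvg_cst].
exact: (cvgM c c).
Qed.

Lemma rphi_lt (x y : R) : 0 <= x -> x < y -> rphi r x < rphi r y.
Proof.
move=> x0 xy; have y0 : 0 <= y by rewrite (le_trans x0) // ltW.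
rewrite /rphi ltr_pdivrMr ?rphi_den_gt0 // mulrAC ltr_pdivlMr ?rphi_den_gt0 //.
case/andP: r01 => r0 r1; nra.
Qed.

Lemma rphi01 (t : R) : 0 < t < 1 -> 0 < rphi r t < 1.
Proof.
move=> /andP[t0 t1]; have := rphi_lt (lexx 0) t0; have := rphi_lt (ltW t0) t1.
by rewrite /rphi mul0r subrr mul0r add0r divr1 => -> ->.
Qed.

Lemma rphi_surj (x : R) : 0 < x < 1 -> exists2 t, 0 < t < 1 & rphi r t = x.
Proof.
move=> /andP[x0 x1]; case/andP: r01 => r0 r1.
have d0 : 0 < 1 - x * r by nra.
(* This is the equation [rphi r t = x] solved for [t]. *)
exists (x * (1 - r) / (1 - x * r)).
  apply/andP; split; first by apply: divr_gt0 => //; nra.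
  by rewrite ltr_pdivrMr // mul1r; nra.
by rewrite /rphi; field; nra.
Qed.

(** The substitution rule is used on compact intervals [I k] exhausting the open unit interval,
    since the integrand is only known to be continuous inside it; [J k] is the image of [I k].
    Starting at [1 / 3] ensures [q k < 1 - q k]. *)
Let q (k : nat) : R := k.+3%:R^-1.
Let I (k : nat) : set R := `[q k, 1 - q k]%classic.
Let J (k : nat) : set R := `[rphi r (q k), rphi r (1 - q k)]%classic.

Let invk_gt0 k : 0 < q k. Proof. by rewrite invr_gt0. Qed.

Let invk_lt1 k : q k < 1 - q k.
Proof.
have : q k <= 3^-1 by rewrite lef_pV2 ?posrE // ler_nat.
lra.
Qed.

Let invk_le m n : (m <= n)%N -> q n <= q m :> R.
Proof. by move=> mn; rewrite lef_pV2 ?posrE // ler_nat. Qed.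

Let rphi_le (x y : R) : 0 <= x -> x <= y -> rphi r x <= rphi r y.
Proof. by move=> x0; rewrite le_eqVlt => /predU1P[->//|xy]; exact/ltW/rphi_lt. Qed.

Let I_nd : nondecreasing_seq I.
Proof.
move=> m n mn; rewrite subsetEset => x; rewrite /I /= !in_itv /= => /andP[a b].
by have c := invk_le mn; apply/andP; split; lra.
Qed.

Let J_nd : nondecreasing_seq J.
Proof.
move=> m n mn; rewrite subsetEset => x; rewrite /J /= !in_itv /= => /andP[a b].
have c := invk_le mn; apply/andP; split.
  by apply: le_trans a; apply: rphi_le => //; exact/ltW/invk_gt0.
apply: (le_trans b); apply: rphi_le; last by rewrite lerD2l lerN2.
by have := invk_lt1 m; have := invk_gt0 m; lra.
Qed.

Let I_exhaust (t : R) : 0 < t < 1 -> exists k, I k t.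
Proof.
move=> /andP[t0 t1]; pose d := Num.min t (1 - t).
have d0 : 0 < d by rewrite lt_min t0 subr_gt0.
exists (Num.bound d^-1); rewrite /I /= in_itv /=.
have kd : q (Num.bound d^-1) <= d.
  rewrite /q -[X in _ <= X]invrK lef_pV2 ?posrE ?invr_gt0 //.
  apply: le_trans (ltW (archi_boundP _)) _; first by rewrite invr_ge0 ltW.
  by rewrite ler_nat -addn3 leq_addr.
move: kd; rewrite le_min => /andP[-> /=]; lra.
Qed.

Let I_bigcup : \bigcup_k I k = U01.
Proof.
apply/seteqP; split => x /=.
  move=> [k _]; rewrite /I /= !in_itv /= => /andP[a b].
  by have := invk_gt0 k; move=> c; apply/andP; split; lra.
by rewrite in_itv /= => /I_exhaust[k Ik]; exists k.
Qed.

Let J_bigcup : \bigcup_k J k = U01.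
Proof.
apply/seteqP; split => x /=.
  move=> [k _]; rewrite /J /= !in_itv /= => /andP[a b].
  have c := invk_gt0 k; have d := invk_lt1 k.
  have /andP[e _] : 0 < rphi r (q k) < 1 by apply: rphi01; lra.
  have /andP[_ f] : 0 < rphi r (1 - q k) < 1 by apply: rphi01; lra.
  by rewrite (lt_le_trans e a) (le_lt_trans b f).
rewrite in_itv /= => /rphi_surj[t /[dup] t01 /I_exhaust[k Ik] <-]; exists k => //.
move: Ik; rewrite /I /J /= !in_itv /= => /andP[a b]; apply/andP; split.
  by apply: rphi_le => //; exact/ltW/invk_gt0.
by apply: rphi_le => //; case/andP: t01 => /ltW.
Qed.

Lemma measurable_fun_oo01 (G : R -> R) : {in `]0, 1[, continuous G} ->
  measurable_fun U01 G.
Proof.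
move=> Gc; apply: open_continuous_measurable_fun => //.
by move=> x; rewrite inE; exact: Gc.
Qed.

Lemma continuous_subst (G : R -> R) : {in `]0, 1[, continuous G} ->
  {in `]0, 1[, continuous (fun t => G (rphi r t) * drphi r t)}.
Proof.
move=> Gc t; rewrite in_itv /= => t01; have /andP[/ltW t0 _] := t01.
apply: cvgM; last exact: continuous_drphi.
apply: (cvg_comp _ _ (continuous_rphi t0)); apply: Gc.
by rewrite in_itv /= rphi01.
Qed.

(** By monotone convergence both sides are limits of integrals over [J k] and [I k], which agree for
    each [k]. *)
Lemma ge0_integral_subst (G : R -> R) : {in `]0, 1[, continuous G} ->
  (forall x, x \in `]0, 1[ -> 0 <= G x) ->
  (\int[mu]_(x in U01) (G x)%:E =
   \int[mu]_(t in U01) (G (rphi r t) * drphi r t)%:E)%E.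
Proof.
move=> Gc G0.
have JS k : J k `<=` U01 by rewrite -J_bigcup; exact: bigcup_sup.
have IS k : I k `<=` U01 by rewrite -I_bigcup; exact: bigcup_sup.
have L1 : (\int[mu]_(x in J k) (G x)%:E @[k --> \oo] -->
    \int[mu]_(x in U01) (G x)%:E)%E.
  rewrite -J_bigcup; apply: ge0_nondecreasing_set_cvg_integral => //.
  - move=> k; exact: measurable_itv.
  - move=> k; apply: (@measurable_funS _ _ _ _ U01 _ _ (measurable_itv _) (JS k)).
    by apply/measurable_EFinP; exact: measurable_fun_oo01.
  - by move=> k x /JS xk; rewrite lee_fin G0.
have L2 : (\int[mu]_(x in I k) (G (rphi r x) * drphi r x)%:E @[k --> \oo] -->
    \int[mu]_(x in U01) (G (rphi r x) * drphi r x)%:E)%E.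
  rewrite -I_bigcup; apply: ge0_nondecreasing_set_cvg_integral => //.
  - move=> k; exact: measurable_itv.
  - move=> k; apply: (@measurable_funS _ _ _ _ U01 _ _ (measurable_itv _) (IS k)).
    by apply/measurable_EFinP; exact: (measurable_fun_oo01 (continuous_subst Gc)).
  - move=> k x /IS; rewrite /= in_itv /= => x01; rewrite lee_fin mulr_ge0 //.
      by rewrite G0 // in_itv /= rphi01.
    by apply/ltW/drphi_gt0; case/andP: x01 => /ltW.
suff E : (fun k => \int[mu]_(x in J k) (G x)%:E)%E =
    (fun k => \int[mu]_(x in I k) (G (rphi r x) * drphi r x)%:E)%E.
  by rewrite E in L1; exact: (cvg_unique (@ereal_hausdorff R) L1 L2).
apply/funext => k; rewrite /I /J.
set a := q k; have a0 : 0 < a by exact: invk_gt0.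
set b := 1 - a; have ab : a < b by exact: invk_lt1.
have b1 : b < 1 by rewrite /b; lra.
have D (t : R) : a <= t -> is_derive t 1 (rphi r) (drphi r t).
  by move=> at_; apply: is_derive_rphi; rewrite (le_trans (ltW a0)).
have Dc (t : R) : a <= t -> {for t, continuous (rphi r)}.
  by move=> at_; apply: continuous_rphi; rewrite (le_trans (ltW a0)).
have dc (t : R) : a <= t -> {for t, continuous (drphi r)}.
  by move=> at_; apply: continuous_drphi; rewrite (le_trans (ltW a0)).
have dE (t : R) : a <= t -> derive1 (rphi r) t = drphi r t.
  by move=> at_; rewrite derive1E; exact: (@derive_val _ _ _ _ _ _ _ (D t at_)).
rewrite integration_by_substitution_increasing.
- apply: eq_integral => t; rewrite inE /= in_itv /= => /andP[at_ _].
  by rewrite /= !fctE dE.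
- exact: ltW.
- move=> x y; rewrite !in_itv /= => /andP[ax _] _ xy; apply: rphi_lt => //.
  by rewrite (le_trans (ltW a0)).
- move=> x; rewrite in_itv /= => /andP[ax _].
  rewrite /continuous_at dE; last exact: ltW.
  apply: cvg_trans (dc x (ltW ax)); apply: near_eq_cvg; near=> t.
  by rewrite dE // ltW //; near: t; exact: lt_nbhsr.
- apply/cvg_ex; exists (drphi r a).
  apply: cvg_trans (cvg_at_right_filter (dc a (lexx a))); apply: near_eq_cvg; near=> t.
  by rewrite dE //; near: t; exact: nbhs_right_ge.
- apply/cvg_ex; exists (drphi r b).
  apply: cvg_trans (cvg_at_left_filter (dc b (ltW ab))); apply: near_eq_cvg; near=> t.
  by rewrite dE //; near: t; exact: nbhs_left_ge.
- split.
  + move=> x; rewrite in_itv /= => /andP[ax _].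
    by have [] := D x (ltW ax).
  + exact: cvg_at_right_filter (Dc a (lexx a)).
  + exact: cvg_at_left_filter (Dc b (ltW ab)).
- apply: continuous_in_subspaceT => x; rewrite inE => xJ; apply: Gc.
  by apply: (JS k).
Unshelve. all: by end_near. Qed.

(** Positive and negative parts are substituted separately; [drphi] is positive and therefore passes
    through the maximum with 0. *)
Lemma integral_subst (G : R -> R) : {in `]0, 1[, continuous G} ->
  (\int[mu]_(x in U01) (G x)%:E =
   \int[mu]_(t in U01) (G (rphi r t) * drphi r t)%:E)%E.
Proof.
move=> Gc; rewrite integralE [RHS]integralE.
have E (F : R -> R) : {in `]0, 1[, continuous F} ->
    (\int[mu]_(x in U01) (Num.max (F x) 0)%:E =
     \int[mu]_(t in U01) (Num.max (F (rphi r t) * drphi r t) 0)%:E)%E.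
  move=> Fc; rewrite (ge0_integral_subst (G := fun x => Num.max (F x) 0)).
  - apply: eq_integral => t; rewrite inE /= in_itv /= => /andP[t0 _]; congr EFin.
    by rewrite maxr_pMl ?mul0r // ltW // drphi_gt0 // ltW.
  - by move=> x x01; apply: (@continuous_max _ _ F (fun=> 0)); [exact: Fc|exact: cvg_cst].
  - by move=> x _; rewrite le_max lexx orbT.
congr (_ - _)%E.
- transitivity (\int[mu]_(x in U01) (Num.max (G x) 0)%:E)%E.
    by apply: eq_integral => x _; rewrite funeposE EFin_max.
  by rewrite E //; apply: eq_integral => x _; rewrite funeposE EFin_max.
- transitivity (\int[mu]_(x in U01) (Num.max (- G x) 0)%:E)%E.
    by apply: eq_integral => x _; rewrite funenegE EFin_max.
  rewrite (E (fun x => - G x)); last first.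
    by move=> x x01; apply: continuousN; exact: Gc.
  by apply: eq_integral => x _; rewrite funenegE EFin_max mulNr.
Qed.

Lemma phi_real (t : R) : phi t r%:C = (rphi r t)%:C.
Proof. by rewrite /phi /rphi fmorph_div /= rmorphD rmorphM rmorphB !rmorph1. Qed.

Lemma drphi_complex (t : R) :
  (1 - r%:C) / ((t%:C - 1) * r%:C + 1) ^+ 2 = (drphi r t)%:C.
Proof.
by rewrite /drphi fmorph_div /= rmorphXn /= !(rmorphD, rmorphN, rmorphM, rmorph1).
Qed.

Lemma eq_cint01 (H1 H2 : R -> C) : {in `]0, 1[, H1 =1 H2} -> cint01 H1 = cint01 H2.
Proof.
by move=> H; rewrite /cint01; congr (_ +i* _); apply: eq_Rintegral => x;
  rewrite inE => xD /=; rewrite H.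
Qed.

Lemma cint01_subst (H : R -> C) :
  {in `]0, 1[, continuous (fun x => complex.Re (H x))} ->
  {in `]0, 1[, continuous (fun x => complex.Im (H x))} ->
  cint01 H = cint01 (fun t => (drphi r t)%:C * H (rphi r t)).
Proof.
move=> Hr Hi; rewrite /cint01; congr (_ +i* _); rewrite /Rintegral /=.
  rewrite (integral_subst Hr); congr fine; apply: eq_integral => t _.
  by rewrite ReM_real mulrC.
rewrite (integral_subst Hi); congr fine; apply: eq_integral => t _.
by rewrite ImM_real mulrC.
Qed.

End Substitution.

(** * Integrability and linearity for complex-valued integrands *)

Definition cintegrable (H : R -> C) :=
  mu.-integrable U01 (fun x => (complex.Re (H x))%:E) /\
  mu.-integrable U01 (fun x => (complex.Im (H x))%:E).

Lemma cint01Z (a : C) (H : R -> C) : cintegrable H ->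
  cint01 (fun x => a * H x) = a * cint01 H.
Proof.
case: a => a b [Hr Hi]; rewrite /cint01.
have E1 x : complex.Re ((a +i* b) * H x) = a * complex.Re (H x) - b * complex.Im (H x).
  by case: (H x).
have E2 x : complex.Im ((a +i* b) * H x) = a * complex.Im (H x) + b * complex.Re (H x).
  by case: (H x).
have iZ (k : R) (F : R -> R) : mu.-integrable U01 (fun x => (F x)%:E) ->
    mu.-integrable U01 (EFin \o (fun x => k * F x)).
  move=> iF; have -> : EFin \o (fun x => k * F x) = (fun x => k%:E * (F x)%:E)%E.
    by apply/funext => x; rewrite /= EFinM.
  exact: integrableZl.
have mU : measurable U01 by exact: measurable_itv.
have -> : (fun x => complex.Re ((a +i* b) * H x)) =
    (fun x => a * complex.Re (H x) - b * complex.Im (H x)) by apply/funext.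
have -> : (fun x => complex.Im ((a +i* b) * H x)) =
    (fun x => a * complex.Im (H x) + b * complex.Re (H x)) by apply/funext.
rewrite RintegralB //; try exact: iZ.
rewrite RintegralD //; try exact: iZ.
rewrite !RintegralZl //.
Qed.

Lemma cintegrableZ (a : C) (H : R -> C) : cintegrable H -> cintegrable (fun x => a * H x).
Proof.
case: a => a b [Hr Hi].
have mU : measurable U01 by exact: measurable_itv.
split.
  have -> : (fun x => (complex.Re ((a +i* b) * H x))%:E) =
      (fun x => a%:E * (complex.Re (H x))%:E - b%:E * (complex.Im (H x))%:E)%E.
    by apply/funext => x; case: (H x).
  by apply: integrableB => //; exact: integrableZl.
have -> : (fun x => (complex.Im ((a +i* b) * H x))%:E) =
    (fun x => a%:E * (complex.Im (H x))%:E + b%:E * (complex.Re (H x))%:E)%E.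
  by apply/funext => x; case: (H x).
by apply: integrableD => //; exact: integrableZl.
Qed.

Lemma holomorphic_continuous_ReIm (f : C -> C) : holomorphic f ->
  {in `]0, 1[, continuous (fun x : R => complex.Re (f x%:C))} /\
  {in `]0, 1[, continuous (fun x : R => complex.Im (f x%:C))}.
Proof.
move=> fh.
have fc (x : R) : x \in `]0, 1[ -> (f y%:C : C^o) @[y --> x] --> (f x%:C : C^o).
  rewrite in_itv /= => /andP[x0 x1].
  have xD : disk x%:C by rewrite real_complex_disk gtr0_norm.
  exact: cvg_comp _ _ (@continuous_real_complex R x) (holomorphic_continuous fh xD).
split=> x /fc xc.
  exact: cvg_comp _ _ xc (@continuous_Re R (f x%:C)).
exact: cvg_comp _ _ xc (@continuous_Im R (f x%:C)).
Qed.

(** For [f] in the unit ball, [|f x|] is at most the norm of the point evaluation at [x], whose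
    integral is finite, and [h] is bounded. *)
Lemma cintegrable_weighted (u : C -> R) (f h : C -> C) :
  (\int[mu]_(s in U01) delta_norm u s%:C < +oo)%E ->
  Hinf_u u f -> (unorm u f <= 1)%E -> Hinf h ->
  cintegrable (fun x : R => f x%:C * h x%:C).
Proof.
move=> hint fu f1 [hh [M hM]].
have [Hr Hi] := holomorphic_continuous_ReIm (holomorphicM fu.1 hh).
pose N := `|M| + 1; have N0 : 0 < N by rewrite ltr_wpDl.
have key (F : R -> R) : {in `]0, 1[, continuous F} ->
    (forall x : R, `|F x| <= modulus (f x%:C * h x%:C)) ->
    mu.-integrable U01 (fun x => (F x)%:E).
  move=> Fc Fb.
  have mF : measurable_fun U01 F by exact: measurable_fun_oo01.
  (* After division by [N] the integrand is dominated by [delta_norm] itself, and integrals can be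
     compared without knowing that [delta_norm] is measurable. *)
  have : mu.-integrable U01 (fun x => (N^-1 * F x)%:E).
    apply/integrableP; split.
      by apply/measurable_EFinP; apply: measurable_funM.
    apply: le_lt_trans hint; apply: ge0_le_integral_nomeas => // x.
    rewrite /= in_itv /= => /andP[x0 x1]; apply: (@le_trans _ _ (modulus (f x%:C))%:E); last first.
      by apply: ereal_sup_ubound; exists f.
    rewrite lee_fin normrM gtr0_norm ?invr_gt0 // mulrC ler_pdivrMr //.
    apply: le_trans (Fb x) _; rewrite modulusM ler_wpM2l ?modulus_ge0 //.
    apply: le_trans (hM _ _) _; first by rewrite real_complex_disk gtr0_norm.
    by rewrite /N; have := ler_norm M; lra.
  move=> iF; have -> : (fun x => (F x)%:E) = (fun x => N%:E * (N^-1 * F x)%:E)%E.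
    by apply/funext => x; rewrite -EFinM mulVKf // gt_eqF.
  by apply: integrableZl => //; exact: measurable_itv.
split; apply: key => // x; [exact: normr_Re_le|exact: normr_Im_le].
Qed.

End Integrals.

(** * The operator on test functions *)

Section EssentialNorm.
Variable R : realType.
Local Notation C := R[i].
Local Notation mu := (@lebesgue_measure R).
Local Notation U01 := (`]0, 1[%classic : set R).

Lemma limn_einfE (x : nat -> \bar R) : limn_einf x = limf_einf x \oo.
Proof. by []. Qed.

Lemma lte_dense_real (x y : \bar R) : (x < y)%E -> exists b : R, (x < b%:E < y)%E.
Proof.
case: x => [x||]; case: y => [y||] //=.
- rewrite lte_fin => xy; exists ((x + y) / 2).
  by rewrite !lte_fin midf_lt // midf_lt.
- by move=> _; exists (x + 1); rewrite lte_fin ltrDl ltr01 ltry.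
- by move=> _; exists (y - 1); rewrite lte_fin ltrBlDr ltrDl ltr01 ltNyr.
- by move=> _; exists 0; rewrite ltNyr ltry.
Qed.

Lemma lee_real (x y : \bar R) : (forall b : R, (b%:E < x)%E -> (b%:E <= y)%E) -> (x <= y)%E.
Proof.
move=> H; rewrite leNgt; apply/negP => /lte_dense_real[b /andP[yb bx]].
by have := H _ bx; rewrite leNgt yb.
Qed.

(** The conditions on [gamma] and [c] start at index 1, so auxiliary sequences are indexed by the
    predecessor; the shift does not affect the limit inferior, and neither does an error tending to
    0. *)
Lemma le_limn_einf_shift (x y : nat -> \bar R) :
  (forall e : R, 0 < e -> \forall n \near \oo, (x n <= y n.+1 + e%:E)%E) ->
  (limn_einf x <= limn_einf y)%E.
Proof.
move=> H; rewrite !limn_einfE; apply: lee_real => b /lte_dense_real[b' /andP[bb' b'x]].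
have e0 : 0 < b' - b by rewrite subr_gt0 -lte_fin.
have [V VF HV] := limf_einf_lt b'x.
have [N _ HN] := filterI VF (H _ e0).
apply: (@limf_einf_ge _ _ _ _ _ [set n | (N < n)%N]); first by exists N.+1.
move=> [//|n] /= Nn; have [Vn Hn] := HN n Nn.
have := lt_le_trans (HV n Vn) Hn.
rewrite -lteBlDr // -EFinB opprB addrC subrK => /ltW //.
Qed.

Lemma cpow_real (x c : R) : 0 < x -> cpow x%:C c = (x `^ c)%:C.
Proof.
move=> x0; rewrite /cpow /Arg modulus_real gtr0_norm //= lexx divff ?gt_eqF //.
by rewrite acos1 mulr0 cos0 sin0 mulr1.
Qed.

Variables (u : C -> R) (K : C -> C -> C) (g : C -> C).
Hypothesis u_gt0 : forall z, disk z -> 0 < u z.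
Hypothesis g_test : is_test_function u g.
Hypothesis delta_int : (\int[mu]_(s in U01) delta_norm u s%:C < +oo)%E.
Hypothesis K_Hinf : forall z, disk z -> Hinf (K z).

Section FixedRadius.
Variables (c r : R) (n : nat).
Hypotheses (c01 : 0 < c < 1) (r01 : 0 < r < 1) (gr : g r%:C != 0).

Let F (z : C) : C := (1 - c)%:C * test_f g c n z.
(** The integrand of [I_op K F] at [r], divided by [F r]; the normalising factor [1 - c] cancels in
    this quotient. *)
Let H (x : R) : C := (F r%:C)^-1 * (F x%:C * K r%:C x%:C).

Let rD : disk r%:C.
Proof. by rewrite real_complex_disk; case/andP: r01 => r0 r1; rewrite gtr0_norm. Qed.

Let c1 : (1 - c)%:C != 0 :> C.
Proof.
by rewrite -(rmorph0 (real_complex R)) (inj_eq (@complexI R)) subr_eq0 gt_eqF //; case/andP: c01.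
Qed.

Let test_fE (x : R) : 0 < x < 1 ->
  test_f g c n x%:C = x%:C ^+ n * g x%:C * ((1 - x) `^ c)%:C.
Proof.
move=> /andP[x0 x1]; rewrite /test_f -(rmorph1 (real_complex R)) -rmorphB cpow_real //.
by rewrite subr_gt0.
Qed.

Lemma scaled_test_f_neq0 : F r%:C != 0.
Proof.
have [r0 r1] := andP r01; rewrite /F test_fE // !mulf_neq0 // ?expf_neq0 //.
  by rewrite -(rmorph0 (real_complex R)) (inj_eq (@complexI R)) gt_eqF.
by rewrite -(rmorph0 (real_complex R)) (inj_eq (@complexI R)) gt_eqF // powR_gt0 // subr_gt0.
Qed.

Lemma C_K_integrand (t : R) : t \in `]0, 1[ ->
  (((1 - t)^-1 - r) `^ (- c))%:C * (phi t r%:C / r%:C) ^+ n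
    * (g (phi t r%:C) / g r%:C) * T_K K t r%:C = (drphi r t)%:C * H (rphi r t).
Proof.
rewrite in_itv /= => t01; have [r0 r1] := andP r01; have [t0 t1] := andP t01.
have p01 := rphi01 r01 t01.
have A0 : 0 < (1 - t)^-1 - r.
  by rewrite subr_gt0 (lt_trans r1) // invf_gt1 ?subr_gt0 // ltrBlDr ltrDl.
have d0 := rphi_den_gt0 r01 (ltW t0).
have pE : 1 - rphi r t = (1 - r) * ((1 - t)^-1 - r)^-1.
  rewrite /rphi; field; rewrite !gt_eqF ?subr_gt0 //=.
  by nra.
have powE : (1 - rphi r t) `^ c = (1 - r) `^ c * ((1 - t)^-1 - r) `^ (- c).
  rewrite pE powRM ?subr_ge0 ?invr_ge0 ?ltW //.
  by rewrite -powR_inv1 ?ltW // -powRrM mulN1r.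
have powEC : ((1 - rphi r t) `^ c)%:C = ((1 - r) `^ c)%:C * (((1 - t)^-1 - r) `^ (- c))%:C :> C.
  by rewrite powE rmorphM.
have r0C : r%:C != 0 :> C by rewrite -(rmorph0 (real_complex R)) (inj_eq (@complexI R)) gt_eqF.
have w0 : ((1 - r) `^ c)%:C != 0 :> C.
  by rewrite -(rmorph0 (real_complex R)) (inj_eq (@complexI R)) gt_eqF // powR_gt0 // subr_gt0.
rewrite /T_K drphi_complex // phi_real // /H /F !test_fE // powEC.
rewrite expr_div_n.
move: w0 gr r0C c1; set w := ((1 - r) `^ c)%:C; set a := (1 - c)%:C; set gr' := g r%:C.
set p := (rphi r t)%:C; set k := K _ _; set v := (_ `^ (- c))%:C; set d := (drphi r t)%:C.
set gp := g p; set rc := r%:C => w0 g0 r0C a0.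
have rn : rc ^+ n != 0 by exact: expf_neq0.
move: (rc ^+ n) rn (p ^+ n) => rcn rcn0 pn.
by clearbody w a; field; rewrite w0 g0 a0 rcn0.
Qed.

Lemma cintegrable_scaled_test_f : cintegrable (fun x : R => F x%:C * K r%:C x%:C).
Proof.
have [Fu _] := H0_u_test_f u_gt0 g_test n c01.
apply: (cintegrable_weighted (u := u)) => //; last exact: K_Hinf.
apply/unorm_leP => z zD; apply: le_trans (ler_modulus_test_f u_gt0 g_test n _ zD) _.
  by case/andP: c01 => /ltW -> ->.
by apply: exprn_ile1; [exact: modulus_ge0|exact: ltW].
Qed.

Let H_continuous :
  {in `]0, 1[, continuous (fun x : R => complex.Re (H x))} /\
  {in `]0, 1[, continuous (fun x : R => complex.Im (H x))}.
Proof.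
have Fh : holomorphic F by have [[]] := H0_u_test_f u_gt0 g_test n c01.
have [Kh _] := K_Hinf rD.
exact: (holomorphic_continuous_ReIm
  (holomorphicM (@holomorphic_cst R (F r%:C)^-1) (holomorphicM Fh Kh))).
Qed.

Lemma C_K_eq : C_K K g c n r = (F r%:C)^-1 * I_op K F r%:C.
Proof.
have [Hr Hi] := H_continuous.
rewrite /C_K (eq_cint01 C_K_integrand) -(cint01_subst r01 Hr Hi).
by rewrite (cint01Z _ cintegrable_scaled_test_f).
Qed.

Lemma C_K_integrand_measurable :
  measurable_fun U01 (fun t : R => complex.Re ((drphi r t)%:C * H (rphi r t))).
Proof.
have [Hr _] := H_continuous.
apply: measurable_fun_oo01.
suff -> : (fun t : R => complex.Re ((drphi r t)%:C * H (rphi r t))) =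
    (fun t => complex.Re (H (rphi r t)) * drphi r t) by exact: (continuous_subst r01 Hr).
by apply/funext => t; rewrite ReM_real mulrC.
Qed.

(** Fatou's lemma concerns extended real integrals, whereas [C_K] is built from their real values
    through [fine]. The two agree once the integral is finite, which is seen before substitution, in
    the variable [x]. *)
Lemma Re_C_K : (\int[mu]_(t in U01) (complex.Re ((drphi r t)%:C * H (rphi r t)))%:E =
  (complex.Re (C_K K g c n r))%:E)%E.
Proof.
have [Hr Hi] := H_continuous.
have -> : (\int[mu]_(t in U01) (complex.Re ((drphi r t)%:C * H (rphi r t)))%:E =
    \int[mu]_(x in U01) (complex.Re (H x))%:E)%E.
  rewrite (integral_subst r01 Hr); apply: eq_integral => t _.
  by rewrite ReM_real mulrC.
rewrite C_K_eq -(cint01Z _ cintegrable_scaled_test_f) /= /Rintegral fineK //.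
have [HI _] := cintegrableZ (F r%:C)^-1 cintegrable_scaled_test_f.
by apply: integrable_fin_num => //; exact: measurable_itv.
Qed.

End FixedRadius.
End EssentialNorm.

(** * Lower bounds for the essential norm *)

Section LowerBound.
Variable R : realType.
Local Notation C := R[i].
Local Notation mu := (@lebesgue_measure R).
Local Notation U01 := (`]0, 1[%classic : set R).
Variables (u : C -> R) (K : C -> C -> C) (g : C -> C).
Hypothesis u_gt0 : forall z, disk z -> 0 < u z.
Hypothesis g_test : is_test_function u g.
Hypothesis delta_int : (\int[mu]_(s in U01) delta_norm u s%:C < +oo)%E.
Hypothesis K_Hinf : forall z, disk z -> Hinf (K z).
Variables (delta : R) (gamma c : nat -> R).
Hypothesis delta_gt0 : 0 < delta.
Hypothesis g_neq0 : forall x : R, delta < x < 1 -> g x%:C != 0.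
Hypothesis gammaP : forall n, (1 <= n)%N -> 0 < gamma n < 1 - delta.
Hypothesis cP : forall n, (1 <= n)%N -> 0 < c n < n%:R^-1.

Let infC n := ereal_inf [set (modulus (C_K K g (c n) n r))%:E
                        | r in `](1 - gamma n)%R, 1%R[].

Let c01 n : (1 <= n)%N -> 0 < c n < 1.
Proof.
move=> n1; have /andP[-> cn] := cP n1; apply: lt_le_trans cn _.
by rewrite invf_le1 ?ler1n // ltr0n.
Qed.

Let radius01 n r : (1 <= n)%N -> 1 - gamma n < r < 1 -> delta < r < 1.
Proof. by move=> n1 /andP[rg ->]; have := gammaP n1; lra. Qed.

Lemma infC_le_essential_norm (X : set (C -> C)) (L : (C -> C) -> (C -> C)) :
  (forall n, (1 <= n)%N ->
      ((1 - n%:R^-1)%:E <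
        ereal_sup [set (modulus (test_f g (c n) n r%:C) * u r%:C)%:E
                  | r in `](1 - gamma n)%R, 1%R[])%E) ->
  H0_u u `<=` X -> compact_op u X L ->
  (limn_einf infC <= op_norm u X (fun f z => (I_op K f z - L f z)%R))%E.
Proof.
(* With [e = (b - b') / 2] one has [b' + e = b - e], whereas [(1 - q)^2 b >= b - 2 b q >= b - e]. *)
have arith (x q b b' : R) : 0 <= q * (q * b) -> (1 - q) * ((1 - q) * b) <= x ->
    x < b' + (b - b') / 2 -> 2 * b * q <= (b - b') / 2 -> False by nra.
move=> csup HX Lc; set T := op_norm _ _ _.
(* The shift gives [0 < c k.+1 < 1] for every [k]; the bound by [|z|^(k+1)] is weakened to [|z|^k]
   to fit the gliding hump lemma. *)
pose F k z := (1 - c k.+1)%:C * test_f g (c k.+1) k.+1 z.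
have F0 k : H0_u u (F k) by apply: H0_u_test_f => //; exact: c01.
have Fn k z : disk z -> modulus (F k z) * u z <= modulus z ^+ k.
  move=> zD; apply: le_trans (ler_modulus_test_f u_gt0 g_test k.+1 _ zD) _.
    by have /andP[/ltW -> ->] := c01 (ltn0Sn k).
  rewrite exprS ler_piMl ?exprn_ge0 ?modulus_ge0 //; exact: ltW.
have F1 k : (unorm u (F k) <= 1)%E.
  apply/unorm_leP => z zD; apply: le_trans (Fn k z zD) _.
  by apply: exprn_ile1; [exact: modulus_ge0|exact: ltW].
have [s sm sL] := compact_op_cvg0 u_gt0 HX Lc F0 Fn.
have T0 : (0 <= T)%E.
  apply: le_trans (unorm_ge0 u_gt0 _) _; apply: ereal_sup_ubound.
  by exists (F 0%N) => //; split => //; exact: HX.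
apply: lee_real => b' /lte_dense_real[b /andP[bb' bI]].
move: bb'; rewrite lte_fin => bb'.
have [b0|b0] := ltP b' 0; first by apply: le_trans T0; rewrite lee_fin ltW.
rewrite leNgt; apply/negP => Tb'.
have [V VF HV] := limf_einf_lt bI.
pose e := (b - b') / 2; have e0 : 0 < e by rewrite divr_gt0 // subr_gt0.
have [N _ HN] := VF.
have : \forall k \near \oo, [/\ V (s k).+1,
    forall w, disk w -> modulus (L (F (s k)) w) * u w < e & 2 * b / e <= k%:R].
  near=> k; split.
  - apply: HN => /=.
    apply: leq_trans (leqW (homo_ltn_ge sm k)).
    by near: k; exact: nbhs_infty_ge.
  - near: k; exact: sL.
  - near: k; exact: nbhs_infty_ger.
move=> /filter_ex[k [Vk Lk kb]].
set n := (s k).+1 in Vk; have n1 : (1 <= n)%N by [].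
(* At this radius the weighted test function exceeds [1 - 1/n]; it is also in the range of the
   infimum [infC n], hence [|C| > b] there. *)
have [_ [r rI <-]] := ereal_sup_gt (csup n n1).
rewrite lte_fin => fr; have := rI; rewrite /= in_itv /= => /(radius01 n1) dr.
have r01 : 0 < r < 1 by case/andP: dr => dr ->; rewrite (lt_trans delta_gt0).
have rD : disk r%:C by rewrite real_complex_disk gtr0_norm; case/andP: r01.
have ur := u_gt0 rD.
have bC : b < modulus (C_K K g (c n) n r).
  rewrite -lte_fin; apply: lt_le_trans (HV n Vk) _; apply: ereal_inf_lbound.
  by exists r.
have FC := scaled_test_f_neq0 n (c01 n1) r01 (g_neq0 dr).
have IE : I_op K (F (s k)) r%:C = F (s k) r%:C * C_K K g (c n) n r.
  by rewrite (C_K_eq u_gt0 g_test delta_int K_Hinf n (c01 n1) r01 (g_neq0 dr)) mulVKf.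
have IL : modulus (I_op K (F (s k)) r%:C - L (F (s k)) r%:C) * u r%:C < b'.
  apply: (unorm_lt (f := fun z => I_op K (F (s k)) z - L (F (s k)) z) _ rD).
  apply: le_lt_trans Tb'; apply: ereal_sup_ubound.
  by exists (F (s k)) => //; split => //; exact: HX.
have Lr := Lk _ rD.
have I1 : modulus (I_op K (F (s k)) r%:C) * u r%:C < b' + e.
  apply: le_lt_trans (ltrD IL Lr); rewrite -mulrDl ler_wpM2r ?(ltW ur) //.
  by rewrite -{1}[I_op _ _ _](subrK (L (F (s k)) r%:C)) ler_modulusD.
have q0 : 0 <= n%:R^-1 :> R by rewrite invr_ge0.
have q1 : n%:R^-1 <= 1 :> R by rewrite invf_le1 // ler1n.
have cn : c n < n%:R^-1 by have /andP[] := cP n1.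
have bpos : 0 <= b by lra.
(* One factor [1 - 1/n] bounds the normalisation [1 - c n], the other the weighted test function at
   [r]. *)
have I2 : (1 - n%:R^-1) * ((1 - n%:R^-1) * b) <= modulus (I_op K (F (s k)) r%:C) * u r%:C.
  rewrite IE modulusM /F -/n modulusM modulus_real ger0_norm; last by lra.
  have -> : (1 - c n) * modulus (test_f g (c n) n r%:C) * modulus (C_K K g (c n) n r) * u r%:C
    = (1 - c n) * ((modulus (test_f g (c n) n r%:C) * u r%:C)
      * modulus (C_K K g (c n) n r)) by ring.
  have [A B] : 0 <= 1 - n%:R^-1 :> R /\ 1 - n%:R^-1 <= 1 - c n.
    by rewrite subr_ge0 lerD2l lerN2 q1 ltW.
  apply: ler_pM => //; first exact: mulr_ge0.
  by apply: ler_pM => //; exact: ltW.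
have I3 : 2 * b * n%:R^-1 <= e.
  rewrite ler_pdivrMr ?ltr0n // [e * _]mulrC -ler_pdivrMr //; apply: (le_trans kb).
  by rewrite ler_nat (leq_trans (homo_ltn_ge sm k)).
have bq : 0 <= n%:R^-1 * (n%:R^-1 * b) by rewrite !mulr_ge0.
exact: arith bq I2 I1 I3.
Unshelve. all: by end_near. Qed.

(** * The integral of the limit inferior *)

Lemma bernoulli_onem (p : R) n : 0 <= p <= 1 -> 1 - n%:R * (1 - p) <= p ^+ n.
Proof.
move=> /andP[p0 p1]; elim: n => [|n IH]; first by rewrite mul0r subr0 expr0.
have pn : p ^+ n <= 1 by exact: exprn_ile1.
rewrite exprS -natr1; move: (p ^+ n) (n%:R) IH pn => x y IH pn; nra.
Qed.

Let w c r t n : R := ((1 - t)^-1 - r) `^ (- c) * (rphi r t / r) ^+ n.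

(** With [B = 1 / (1 - t)], the first factor is at least [B^(-a) >= 1 - a ln B]. For the second, the
    denominator of [rphi r t] is at least [t], so [1 - rphi r t <= d / t], and Bernoulli's
    inequality applies. Finally [(1 - x)(1 - y) >= 1 - x - y] for nonnegative [x] and [y]. *)
Lemma weight_ge (a r t d : R) (n : nat) : 0 < a -> 0 < r < 1 -> 0 < t < 1 -> 1 - d < r ->
  0 <= n%:R * d / t <= 1 -> a * ln (1 - t)^-1 <= 1 ->
  1 - a * ln (1 - t)^-1 - n%:R * d / t <= w a r t n.
Proof.
move=> a0 r01 t01 dr /andP[x0 x1] y1; have [r0 r1] := andP r01; have [t0 t1] := andP t01.
set B := (1 - t)^-1 in y1 *.
have B1 : 1 < B by rewrite invf_gt1 ?subr_gt0 // ltrBlDr ltrDl.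
have lnB : 0 <= ln B by rewrite ln_ge0 // ltW.
have A0 : 0 < B - r by rewrite subr_gt0 (lt_trans r1).
have wA : 1 - a * ln B <= (B - r) `^ (- a).
  apply: (@le_trans _ _ (expR (- (a * ln B)))); first exact: expR_ge1Dx.
  rewrite expRN powRN lef_pV2 ?posrE ?expR_gt0 ?powR_gt0 //.
  have -> : expR (a * ln B) = B `^ a by rewrite /powR gt_eqF // (lt_trans ltr01).
  apply: ge0_ler_powR; rewrite ?nnegrE //; [exact: ltW|exact: ltW|lra|].
  by rewrite lerBlDr lerDl ltW.
have p01 := rphi01 r01 t01; have [p0 p1] := andP p01.
have d0 := rphi_den_gt0 r01 (ltW t0).
have pd : 1 - rphi r t <= d / t.
  have -> : 1 - rphi r t = (1 - t) * (1 - r) / ((t - 1) * r + 1).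
    by rewrite /rphi; field; rewrite gt_eqF.
  rewrite ler_pdivrMr // mulrAC ler_pdivlMr //.
  apply: ler_pM; [by rewrite mulr_ge0 // subr_ge0 ltW|exact: ltW|nra|nra].
have wP : 1 - n%:R * d / t <= (rphi r t / r) ^+ n.
  apply: (@le_trans _ _ (rphi r t ^+ n)).
    apply: le_trans (bernoulli_onem _ _); last by rewrite !ltW.
    by rewrite lerD2l lerN2 -mulrA ler_wpM2l.
  apply: lerXn2r; rewrite ?nnegrE; [exact: ltW|by rewrite divr_ge0 // ltW|].
  by rewrite ler_pdivlMr // ler_piMr // ltW.
rewrite /w; apply: (@le_trans _ _ ((1 - a * ln B) * (1 - n%:R * d / t))).
  have : 0 <= (a * ln B) * (n%:R * d / t) by rewrite mulr_ge0 // mulr_ge0 // ltW.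
  lra.
by apply: ler_pM => //; lra.
Qed.

Hypothesis ngamma0 : n%:R * gamma n @[n --> \oo] --> (0 : R).
Hypothesis G_ge0 : forall r t : R, 0 < r < 1 -> 0 < t < 1 ->
  0 <= g (phi t r%:C) / g r%:C * T_K K t r%:C.

Let G (t r : R) : R := complex.Re (g (phi t r%:C) / g r%:C * T_K K t r%:C).

Let Gge0 t r : 0 < r < 1 -> 0 < t < 1 -> 0 <= G t r.
Proof. by move=> r01 t01; have := G_ge0 r01 t01; rewrite lecE => /andP[]. Qed.

Let w_ge0 a r t n : 0 < r < 1 -> 0 < t < 1 -> 0 <= w a r t n.
Proof.
move=> r01 t01; have /andP[p0 _] := rphi01 r01 t01.
by rewrite mulr_ge0 ?powR_ge0 // exprn_ge0 // divr_ge0 ?(ltW p0) //; case/andP: r01 => /ltW.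
Qed.

Lemma integrandE a r t n : 0 < r < 1 ->
  complex.Re ((((1 - t)^-1 - r) `^ (- a))%:C * (phi t r%:C / r%:C) ^+ n
    * (g (phi t r%:C) / g r%:C) * T_K K t r%:C) = w a r t n * G t r.
Proof.
move=> r01; rewrite /G -ReM_real /w phi_real // -mulrA.
have wC (x y z : R) : (x * (y / z) ^+ n)%:C = x%:C * (y%:C / z%:C) ^+ n :> C.
  by rewrite -fmorph_div -rmorphXn -rmorphM.
by rewrite wC.
Qed.

Lemma liminf_integrand (rn : nat -> R) (t : R) : 0 < t < 1 ->
  (forall n, 0 < rn n < 1) -> (forall n, 1 - gamma n.+1 < rn n) ->
  (limf_einf (fun r : R => (G t r)%:E) (1%R : R)^'- <=
   limn_einf (fun n => (w (c n.+1) (rn n) t n.+1 * G t (rn n))%:E))%E.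
Proof.
move=> t01 rn01 rng; have [t0 t1] := andP t01.
apply: lee_real => b /lte_dense_real[b' /andP[bb' b'G]].
move: bb'; rewrite lte_fin => bb'.
rewrite limn_einfE.
have [b0|b0] := leP b 0.
  apply: (@limf_einf_ge _ _ _ _ _ setT); first exact: filterT.
  by move=> n _; rewrite lee_fin (le_trans b0) // mulr_ge0 ?w_ge0 ?Gge0.
have [V VF HV] := limf_einf_lt b'G.
have b'0 : 0 < b' by exact: lt_trans bb'.
(* Chosen so that [1 - 2 e = b / b']: the two losses in the weight may cost [e] each, and then the
   weight times [b'] is still at least [b]. *)
pose e := (1 - b / b') / 2.
have e0 : 0 < e by rewrite divr_gt0 // subr_gt0 ltr_pdivrMr // mul1r.
have e1 : e <= 1.
  by have : 0 < b / b' by [rewrite divr_gt0|]; rewrite /e; lra.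
have [d /= d0 Hd] := VF.
pose B := ln (1 - t)^-1.
have B0 : 0 <= B.
  by apply: ln_ge0; rewrite ltW // invf_gt1 ?subr_gt0 // ltrBlDr ltrDl.
(* As [gamma n <= n * gamma n], the bound by [d] places [rn n] where [G] exceeds [b']; the bound by
   [e * t] controls the loss from the [n]-th power. *)
have te0 : 0 < Num.min d (e * t) by rewrite lt_min d0 mulr_gt0.
have ng1 : n.+1%:R * gamma n.+1 @[n --> \oo] --> (0 : R).
  by rewrite (cvg_shiftS (fun n => n%:R * gamma n)).
have E : \forall n \near \oo, [/\ n.+1%:R * gamma n.+1 < Num.min d (e * t) & B / e <= n%:R].
  near=> n; split; last by near: n; exact: nbhs_infty_ger.
  by near: n; exact: (cvgr_lt _ ng1).
apply: (limf_einf_ge E) => n [ng Bn]; rewrite lee_fin.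
have [gn0 _] := andP (gammaP (ltn0Sn n)).
have [cn0 cn1] := andP (cP (ltn0Sn n)).
move: ng; rewrite lt_min => /andP[gd ge].
have gg : gamma n.+1 <= n.+1%:R * gamma n.+1 by rewrite ler_peMl ?ler1n // ltW.
have Gb : b' <= G t (rn n).
  rewrite -lee_fin ltW //; apply: HV; apply: Hd => /=; last by case/andP: (rn01 n).
  have := rng n; have /andP[_ r1] := rn01 n; rewrite gtr0_norm ?subr_gt0 //; lra.
have x1 : n.+1%:R * gamma n.+1 / t <= e by rewrite ler_pdivrMr // ltW.
have y1 : c n.+1 * B <= e.
  apply: (@le_trans _ _ (n.+1%:R^-1 * B)); first by rewrite ler_wpM2r // ltW.
  rewrite mulrC ler_pdivrMr ?ltr0n // mulrC -ler_pdivrMr //.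
  by apply: le_trans Bn _; rewrite ler_nat.
have wb : b / b' <= w (c n.+1) (rn n) t n.+1.
  apply: le_trans (weight_ge (d := gamma n.+1) cn0 (rn01 n) t01 (rng n) _ _).
  - by move: x1 y1; rewrite /e; rewrite -/B; lra.
  - rewrite (le_trans x1 e1) andbT divr_ge0 ?(ltW t0) // mulr_ge0 // ltW //.
  - exact: le_trans y1 e1.
rewrite -[b](divfK (lt0r_neq0 b'0)); apply: ler_pM => //; rewrite ?(ltW b'0) //.
by rewrite divr_ge0 // ltW.
Unshelve. all: by end_near. Qed.

Lemma integral_liminf_le_infC :
  (\int[mu]_(t in U01) limf_einf (fun r : R => (G t r)%:E) (1%R : R)^'- <= limn_einf infC)%E.
Proof.
(* The infimum need not be attained, so the radius is optimal up to [1 / (n + 1)]. Its existence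
   requires a finite infimum, bounded here by the value at the midpoint [1 - gamma n.+1 / 2]. *)
have rnP n : exists r : R, 1 - gamma n.+1 < r < 1 /\
    ((modulus (C_K K g (c n.+1) n.+1 r))%:E < infC n.+1 + (n.+1%:R^-1)%:E)%E.
  have [g0 gd] := andP (gammaP (ltn0Sn n)).
  have fin : infC n.+1 \is a fin_num.
    rewrite ge0_fin_numE.
      apply: (@le_lt_trans _ _ (modulus (C_K K g (c n.+1) n.+1 (1 - gamma n.+1 / 2)))%:E).
        apply: ereal_inf_lbound; exists (1 - gamma n.+1 / 2) => //=.
        by rewrite in_itv /=; apply/andP; split; lra.
      exact: ltry.
    by apply: le_ereal_inf_tmp => _ [r _ <-]; rewrite lee_fin modulus_ge0.
  have [|_ [r rI <-] H] := lb_ereal_inf_adherent (e := n.+1%:R^-1) _ fin.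
    by rewrite invr_gt0.
  by exists r; split => //; move: rI; rewrite /= in_itv.
have [rn Hrn] := choice rnP.
have rd n : delta < rn n < 1 by exact: (radius01 (ltn0Sn n) (Hrn n).1).
have r01 n : 0 < rn n < 1 by have /andP[dr ->] := rd n; rewrite (lt_trans delta_gt0).
pose P n t := (complex.Re ((((1 - t)^-1 - rn n) `^ (- c n.+1))%:C
    * (phi t (rn n)%:C / (rn n)%:C) ^+ n.+1
    * (g (phi t (rn n)%:C) / g (rn n)%:C) * T_K K t (rn n)%:C))%:E.
have PE n t : P n t = (w (c n.+1) (rn n) t n.+1 * G t (rn n))%:E.
  by rewrite /P integrandE.
have P0 n t : U01 t -> (0 <= P n t)%E.
  by rewrite /= in_itv /= => t01; rewrite PE lee_fin mulr_ge0 ?w_ge0 ?Gge0.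
apply: (@le_trans _ _ (\int[mu]_(t in U01) limn_einf (P ^~ t))%E).
  (* The limit inferior over real [r] enters only through this pointwise comparison, which asks for
     no measurability. *)
  apply: ge0_le_integral_nomeas => t; rewrite /= in_itv /= => t01.
    apply: (@limf_einf_ge _ _ _ _ _ [set r : R | 0 < r < 1]).
      near=> r; rewrite /=; apply/andP; split; near: r.
        exact: nbhs_left_gt.
      exact: nbhs_left_lt.
    by move=> r /= r01'; rewrite lee_fin Gge0.
  under [X in limn_einf X]eq_fun do rewrite PE.
  apply: liminf_integrand => // n; by case/andP: (Hrn n).1.
apply: le_trans.
  apply: fatou => //.
  move=> n; apply/measurable_EFinP.
  apply: eq_measurable_fun
    (C_K_integrand_measurable u_gt0 g_test K_Hinf n.+1 (c01 (ltn0Sn n)) (r01 n)).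
  move=> t tI; congr complex.Re; apply/esym/C_K_integrand => //; first exact: c01.
    exact: g_neq0.
  by move: tI; rewrite inE.
apply: le_limn_einf_shift => e e0; near=> n.
apply: (@le_trans _ _ (modulus (C_K K g (c n.+1) n.+1 (rn n)))%:E).
  apply: (@le_trans _ _ (complex.Re (C_K K g (c n.+1) n.+1 (rn n)))%:E); last first.
    by rewrite lee_fin (le_trans (ler_norm _)) // normr_Re_le.
  rewrite -(Re_C_K u_gt0 g_test delta_int K_Hinf n.+1 (c01 (ltn0Sn n)) (r01 n) (g_neq0 (rd n))).
  rewrite le_eqVlt; apply/orP; left; apply/eqP; apply: eq_integral => t tI.
  congr (complex.Re _)%:E; apply: C_K_integrand => //; first exact: c01.
    exact: g_neq0.
  by move: tI; rewrite inE.
apply: le_trans (ltW (Hrn n).2) _; rewrite leeD2l // lee_fin ltW //.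
by near: n; exact: near_infty_natSinv_lt (PosNum e0).
Unshelve. all: by end_near. Qed.

End LowerBound.

Theorem theorem6p1 (R : realType) (u : R[i] -> R) (K : R[i] -> R[i] -> R[i])
    (g : R[i] -> R[i]) (delta : R) (gamma c : nat -> R)
    (hu : is_weight u)
    (hev : forall z, disk z -> (delta_norm u z < +oo)%E)
    (hevint : (\int[lebesgue_measure]_(s in `]0%R, 1%R[) delta_norm u s%:C < +oo)%E)
    (hK : is_kernel K)
    (hIK : bounded_op u (Hinf_u u) (I_op K))
    (hg : is_test_function u g)
    (hdelta : 0 < delta < 1)
    (hgdelta : forall x : R, delta < x < 1 -> g x%:C != 0)
    (hgamma : forall n, (1 <= n)%N -> 0 < gamma n < 1 - delta)
    (hgamma0 : n%:R * gamma n @[n --> \oo] --> (0 : R))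
    (hc : forall n, (1 <= n)%N -> 0 < c n < n%:R^-1)
    (hcsup : forall n, (1 <= n)%N ->
      ((1 - n%:R^-1)%:E <
        ereal_sup [set (modulus (test_f g (c n) n r%:C) * u r%:C)%:E
                  | r in `](1 - gamma n)%R, 1%R[])%E)
    (X : set (R[i] -> R[i])) (hX : X = Hinf_u u \/ X = H0_u u) :
  (limn_einf (fun n => ereal_inf [set (modulus (C_K K g (c n) n r))%:E
                                 | r in `](1 - gamma n)%R, 1%R[])
     <= essential_norm u X (I_op K))%E
  /\
  ((forall r t : R, 0 < r < 1 -> 0 < t < 1 ->
      0 <= g (phi t r%:C) / g r%:C * T_K K t r%:C) ->
   (\int[lebesgue_measure]_(t in `]0%R, 1%R[)
       limf_einf (fun r : R => (complex.Re (g (phi t r%:C) / g r%:C * T_K K t r%:C))%:E)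
         (1%R : R)^'-
     <= essential_norm u X (I_op K))%E).

Proof.
have [u_gt0 _ _ _ _] := hu; have [_ K_Hinf _] := hK; have [delta_gt0 _] := andP hdelta.
have H1 : (limn_einf (fun n => ereal_inf [set (modulus (C_K K g (c n) n r))%:E
    | r in `](1 - gamma n)%R, 1%R[]) <= essential_norm u X (I_op K))%E.
  apply: le_ereal_inf_tmp => _ [L Lc <-].
  apply: (infC_le_essential_norm u_gt0 hg hevint K_Hinf delta_gt0 hgdelta hgamma hc hcsup _ Lc).
  by case: hX => -> f // [].
split=> // G_ge0; apply: le_trans H1.
exact: (integral_liminf_le_infC u_gt0 hg hevint K_Hinf delta_gt0 hgdelta hgamma hc hgamma0 G_ge0).
Qed.
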